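(* Let $L\subseteq\mathbb R^n$ be a convex body and $K\in\mathscr K(\mathbb R^n)$ such that $K\subseteq L$. Let $\mu=(\mu_j)_{j\ge1}$ be an admissible weight satisfying $\mu_j\ge j$ for $j\ge1$ and such that, for a constant $H\ge1$, the sequence $a_j:=\big(\frac{\mu_1\cdots\mu_j}{j!}\big)^{1/j}$ satisfies $a_j\le H\,a_k$ whenever $1\le j\le k$. Let $M_0\ge m_0>0$ and set $\beta_0:=nH\big(1+\tfrac{2M_0}{m_0}\big)$. Assume that $(\mu,2M_0,a_K\beta_0,m_0)$ is admissible and let $\mathbf N=\mathbf N(\mu,2M_0,a_K\beta_0,m_0)$. If $f:L\to\mathbb R$ is $(\mu^{|\mathbf N},M_0)$-smooth and satisfies $\min_{x\in L}|f(x)|\ge m_0$, then $$\max_{x\in K}|f(x)|\le\mathbf C_{\mathbf N}^2\Big(\frac{2^{\nu_K}}{2^{\nu_K}-1}\Big)^{2\mathbf N}\min_{x\in K}|f(x)|.$$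
   Context: $|E|$ denotes Lebesgue measure. A convex body is a compact convex set with nonempty interior. Weights and smoothness. An admissible weight is a sequence $\mu=(\mu_j)_{j\ge1}$ of reals with $0<\mu_1\le\mu_2\le\cdots$. Given $M_0>0$ put $M_j=M_0\mu_1\cdots\mu_j$, $j\ge1$. For $N\in\mathbb N_{\ge1}\cup\{\infty\}$ and nonempty compact $L\subseteq\mathbb R^n$, a map $f=(f_1,\dots,f_m):L\to\mathbb R^m$ is $(\mu^{|N},M_0)$-smooth if it is of class $C^N$ in some open neighborhood of $L$ and $\sup_{x\in L}\sum_{i=1}^m\sum_{|\alpha|=j}\frac{j!}{\alpha!}|\partial^\alpha f_i(x)|\le M_j$ for all integers $0\le j<N+1$. Also $\|f\|_E:=\sup_{x\in E}\sum_{i=1}^m|f_i(x)|$. Degree. For $A,a,b>0$ let $j_0$ be the smallest nonnegative integer $\ge\log(A/b)$. The tuple $(\mu,A,a,b)$ is admissible if $\sum_{j=j_0+1}^\infty 1/\mu_j>a\,e$; then $\mathbf N(\mu,A,a,b):=2\sup\{k\in\mathbb N:\sum_{j=j_0+1}^k\frac1{a\mu_j}<e\}$ (empty sums are $0$). The constant $\mathbf C_{\mathbf N}$. Fix an increasing continuous, (piecewise) $C^1$ function $\tilde\mu:[1,\infty)\to(0,\infty)$ with $\tilde\mu(j)=\mu_j$ for integers $j\ge1$ (left derivatives are used at points of nondifferentiability), put $\gamma_{\tilde\mu}(k):=\sup_{1\le s\le k}\frac{s\tilde\mu'(s)}{\tilde\mu(s)}$, and $\mathbf C_{\mathbf N}:=(4e^{4+\gamma_{\tilde\mu}(\mathbf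 N)})^{\mathbf N}$. Admissible sets. A family $(K_w,a_w,\Upsilon_w)_{w\in W}$, where $W$ is any set, $K_w\subseteq[0,1]^n$ is compact, $a_w\in K_w$, and $\Upsilon_w:[0,\infty)^n\to\mathbb R^n$ is a map, is an admissible collection of degree $d\in\mathbb N_{\ge1}$ if there are constants $\delta_1,\delta_2,\delta_3>0$, $q\in\mathbb N_{\ge1}$ and polynomial maps $R_w:\mathbb R^n\to\mathbb R^n$ of degree at most $d$ such that for all $w\in W$: (1) $K_w$ is star-shaped with respect to $a_w$ and $|K_w|\ge\delta_1$; (2) $\Upsilon_w(x_1,\dots,x_n)=R_w(x_1^{1/q},\dots,x_n^{1/q})$; (3) $\delta_2\le\sum_\kappa|c_{w,\kappa}|\le\delta_3$, where $c_{w,\kappa}$ are the coefficients of the polynomial $\operatorname{Jac}(R_w)$ (the Jacobian determinant); (4) writing $a_w=(a_{w,1},\dots,a_{w,n})$, $a_{w,i}=0$ whenever $\Upsilon_w$ is not a polynomial map with respect to the variable $x_i$. A nonempty compact set $K\subseteq\mathbb R^n$ is admissible (of degree $d$) if there is an admissible collection (of degree $d$) $(K_w,a_w,\Upsilon_w)_{w\in K}$ indexed by $K$ with $\Upsilon_w(a_w)=w$ for each $w\in K$ and $K=\bigcup_{w\in K}\Upsilon_w(K_w)$. $\mathscr K(\mathbb R^n)$ is the family of all admissible sets. For each $K\in\mathscr K(\mathbb R^n)$ such a collection and its degree $d$ are fixed ($d=1$ if $K$ is a convex body), and $$a_K:=4\,\tfrac{(d+1)^{d+1}}{(d-1)^{d-1}}\max\{\operatorname{diam}(K),1\}\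 \text{ if }d\ge2,\qquad a_K:=\operatorname{diam}(K)\ \text{ if }d=1.$$ The constant $\nu_K$. For $K\in\mathscr K(\mathbb R^n)$, $\nu_K\in(0,1]$ denotes a fixed constant depending only on $K$ (with $\nu_K=1/n$ if $K$ is a convex body) for which the paper's Remez inequality holds: for every convex body $L\supseteq K$, every admissible weight $\mu$ with $\mu_j\ge j$, all $M_0>b_0>0$ and $m\ge1$ with $(\mu,mM_0,a_K,b_0)$ admissible and $\mathbf N'=\mathbf N(\mu,mM_0,a_K,b_0)$, every $(\mu^{|\mathbf N'},M_0)$-smooth $f:L\to\mathbb R^m$ with $\|f\|_K\ge b_0$, and every measurable $E\subseteq K$ with $|E|>0$, $\|f\|_K\le\mathbf C_{\mathbf N'}\big(\frac{m|K|^{\nu_K}}{|K|^{\nu_K}-(|K|-|E|)^{\nu_K}}\big)^{\mathbf N'}\|f\|_E$. (Such a constant exists for every $K\in\mathscr K(\mathbb R^n)$.) *)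

(* Defs.v *)
From HB Require Import structures.
From mathcomp Require Import all_boot all_order all_algebra.
From mathcomp Require Import all_classical all_reals all_analysis.
(* Its notations clash with those of MathComp-Analysis. *)
From mathcomp Require Import -(notations) mpoly.

Set Implicit Arguments.
Unset Strict Implicit.
Unset Printing Implicit Defensive.

Import Order.TTheory GRing.Theory Num.Theory.
Import numFieldNormedType.Exports.

Local Open Scope classical_set_scope.
Local Open Scope ring_scope.

Section Geometry.
Variables (R : realType) (n : nat).
Implicit Types (A K : set 'rV[R]_n) (a b x y : 'rV[R]_n).

Definition box a b : set 'rV[R]_n :=
  [set x | forall i, a 0 i <= x 0 i <= b 0 i].

Definition box_volume a b : R := \prod_(i < n) (b 0 i - a 0 i).

(* Lebesgue outer measure on R^n, for n > 0; its restriction to the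
   Caratheodory measurable sets is the (complete) Lebesgue measure. *)
Definition lebesgue_rV A : \bar R :=
  ereal_inf [set (\sum_(k <oo) (box_volume (c.1 k) (c.2 k))%:E)%E
            | c in [set c : (nat -> 'rV[R]_n) * (nat -> 'rV[R]_n) |
                (forall k i, c.1 k 0 i <= c.2 k 0 i) /\
                A `<=` \bigcup_k box (c.1 k) (c.2 k)]].

Definition lebesgue_measurable A : Prop := lebesgue_rV.-caratheodory A.

(* The norm carried by 'rV[R]_n in the library is the sup norm, hence the
   explicit Euclidean distance. *)
Definition euclidean_dist x y : R :=
  Num.sqrt (\sum_(i < n) (x 0 i - y 0 i) ^+ 2).

Definition diam A : R :=
  sup [set euclidean_dist z.1 z.2 | z in A `*` A].

Definition convex_body A : Prop :=
  [/\ compact A, convex_set (A : set (convex_lmodType 'rV[R]_n)) &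
      A° !=set0].

Definition star_shaped A a : Prop :=
  forall x (t : R), A x -> 0 <= t <= 1 -> A (a + t *: (x - a)).

End Geometry.

Section Smoothness.
Variable R : realType.

(* Weights are indexed from 1: the value mu 0 is never used. *)
Definition admissible_weight (mu : nat -> R) : Prop :=
  0 < mu 1%N /\ forall j, (1 <= j)%N -> mu j <= mu j.+1.

Definition weight_bound (mu : nat -> R) (M0 : R) (j : nat) : R :=
  M0 * \prod_(1 <= i < j.+1) mu i.

Section Partial.
Variable n : nat.
Implicit Type g : 'rV[R]_n -> R.

Definition partial (i : 'I_n) g : 'rV[R]_n -> R :=
  fun x => 'D_(delta_mx 0 i) g x.

Definition partials (s : seq 'I_n) g : 'rV[R]_n -> R :=
  foldr partial g s.

Definition multi_partial (alpha : 'I_n -> nat) g : 'rV[R]_n -> R :=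
  partials (flatten [seq nseq (alpha i) i | i <- enum 'I_n]) g.

(* The library's derivative is total, so the existence of each partial
   derivative has to be required. *)
Definition class_C (N : nat) (U : set 'rV[R]_n) g : Prop :=
  (forall s x i, (size s < N)%N -> U x ->
     derivable (partials s g) x (delta_mx 0 i)) /\
  (forall s x, (size s <= N)%N -> U x -> {for x, continuous (partials s g)}).

End Partial.

Variables n m : nat.
Implicit Type f : 'rV[R]_n -> 'rV[R]_m.

Definition component f (i : 'I_m) : 'rV[R]_n -> R := fun x => f x 0 i.

Definition jet_norm f (j : nat) (x : 'rV[R]_n) : R :=
  \sum_(i < m)
    \sum_(alpha : {ffun 'I_n -> 'I_j.+1} | (\sum_k alpha k)%N == j)
      (j`!)%:R / (\prod_k (alpha k)`!)%:R *
      `|multi_partial (fun k => alpha k : nat) (component f i) x|.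

(* f stands for an extension of a map on L to a neighbourhood of L. *)
Definition smooth (mu : nat -> R) (N : nat) (M0 : R)
    (L : set 'rV[R]_n) f : Prop :=
  (exists U : set 'rV[R]_n,
     [/\ open U, L `<=` U & forall i, class_C N U (component f i)]) /\
  (forall j x, (j <= N)%N -> L x -> jet_norm f j x <= weight_bound mu M0 j).

Definition sup_norm (E : set 'rV[R]_n) f : R :=
  sup [set \sum_(i < m) `|f x 0 i| | x in E].

End Smoothness.

Section Degree.
Variable R : realType.
Implicit Types (mu : nat -> R) (A a b : R).

Definition start_index A b : nat :=
  infimum 0%N [set j : nat | ln (A / b) <= j%:R].

Definition admissible_tuple mu A a b : Prop :=
  ((a * expR 1)%:E <
     \sum_((start_index A b).+1 <= j <oo) ((mu j)^-1)%:E)%E.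

Definition degree mu A a b : nat :=
  (2 * supremum 0 [set k : nat |
    (\sum_((start_index A b).+1 <= j < k.+1) (a * mu j)^-1 < expR 1)%R])%N.

(* h agrees on each piece [t_i, t_(i+1)] with a C^1 function on the line, i.e.
   it is C^1 on that closed interval. *)
Definition piecewise_C1 (h : R -> R) : Prop :=
  exists t : nat -> R,
    [/\ t 0%N = 1, forall i, t i < t i.+1, t @ \oo --> +oo &
      forall i, exists g : R -> R,
        [/\ forall x, derivable g x 1, continuous (derive1 g) &
            {in `[t i, t i.+1], h =1 g}]].

(* "Increasing" is nondecreasing, as the weight may be constant somewhere. *)
Definition weight_extension mu (h : R -> R) : Prop :=
  [/\ forall s, 1 <= s -> 0 < h s,
      {in `[1, +oo[ &, {homo h : s t / s <= t}},
      {within `[1, +oo[, continuous h},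
      piecewise_C1 h &
      forall j, (1 <= j)%N -> h j%:R = mu j].

(* The left derivative is the derivative wherever the latter exists; h is only
   relevant on [1, +oo[, so that at 1 the right derivative is used. *)
Definition one_sided_derivative (h : R -> R) (s : R) : R :=
  let quot := fun u : R => (h (s + u) - h s) / u in
  if 1 < s then lim (quot @ 0^'-) else lim (quot @ 0^'+).

Definition gamma (h : R -> R) (k : nat) : R :=
  sup [set s * one_sided_derivative h s / h s
      | s in [set s : R | 1 <= s <= k%:R]].

Definition CN (h : R -> R) (N : nat) : R :=
  (4 * expR (4 + gamma h N)) ^+ N.

End Degree.

Section AdmissibleSets.
Variables (R : realType) (n : nat).

Definition orthant : set 'rV[R]_n := [set x | forall i, 0 <= x 0 i].

Definition polymap := 'I_n -> mpoly n R.

Definition eval_polymap (P : polymap) (x : 'rV[R]_n) : 'rV[R]_n :=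
  \row_i meval (fun k => x 0 k) (P i).

Definition degree_le (P : polymap) (d : nat) : Prop :=
  forall i, (mmeasure (@mdeg n) (P i) <= d.+1)%N.

Definition jac (P : polymap) : mpoly n R :=
  \det (\matrix_(i, j) mderiv j (P i)).

Definition coef_norm (p : mpoly n R) : R :=
  \sum_(k <- msupp p) `|mcoeff k p|.

Definition root_map (q : nat) (x : 'rV[R]_n) : 'rV[R]_n :=
  \row_i (x 0 i `^ (q%:R^-1)).

Definition update (x : 'rV[R]_n) (i : 'I_n) (t : R) : 'rV[R]_n :=
  \row_k (if k == i then t else x 0 k).

Definition polynomial_in_var (Y : 'rV[R]_n -> 'rV[R]_n) (i : 'I_n) : Prop :=
  forall x, orthant x -> exists p : 'I_n -> {poly R},
    forall t, 0 <= t -> forall j, Y (update x i t) 0 j = (p j).[t].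

(* The values of Ups w outside the nonnegative orthant are irrelevant. *)
Definition admissible_collection (T : Type) (W : set T) (d : nat)
    (Kw : T -> set 'rV[R]_n) (aw : T -> 'rV[R]_n)
    (Ups : T -> 'rV[R]_n -> 'rV[R]_n) : Prop :=
  [/\ (1 <= d)%N,
      forall w, W w ->
        [/\ compact (Kw w), Kw w (aw w) &
            forall x, Kw w x -> forall i, 0 <= x 0 i <= 1] &
      exists delta1 delta2 delta3 : R, exists q : nat, exists P : T -> polymap,
        [/\ [/\ 0 < delta1, 0 < delta2 & 0 < delta3],
            (1 <= q)%N,
            forall w, W w -> degree_le (P w) d &
            forall w, W w ->
              [/\ star_shaped (Kw w) (aw w) /\
                    (delta1%:E <= lebesgue_rV (Kw w))%E,
                  forall x, orthant x ->
                    Ups w x = eval_polymap (P w) (root_map q x),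
                  delta2 <= coef_norm (jac (P w)) <= delta3 &
                  forall i, ~ polynomial_in_var (Ups w) i -> aw w 0 i = 0]]].

Definition admissible_set (d : nat) (K : set 'rV[R]_n) : Prop :=
  [/\ K !=set0, compact K &
      exists Kw : 'rV[R]_n -> set 'rV[R]_n,
      exists aw : 'rV[R]_n -> 'rV[R]_n,
      exists Ups : 'rV[R]_n -> 'rV[R]_n -> 'rV[R]_n,
        [/\ admissible_collection K d Kw aw Ups,
            forall w, K w -> Ups w (aw w) = w &
            K = \bigcup_(w in K) (Ups w @` Kw w)]].

(* d is the degree of the admissible collection fixed for K. *)
Definition fixed_degree (K : set 'rV[R]_n) (d : nat) : Prop :=
  admissible_set d K /\ (convex_body K -> d = 1%N).

Definition a_const (K : set 'rV[R]_n) (d : nat) : R :=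
  if (2 <= d)%N then
    4 * ((d.+1 ^ d.+1)%:R / (d.-1 ^ d.-1)%:R) * Num.max (diam K) 1
  else diam K.

Definition remez_inequality (K : set 'rV[R]_n) (d : nat) (nu : R) : Prop :=
  forall (L : set 'rV[R]_n) (mu : nat -> R) (mut : R -> R) (M0 b0 : R)
      (m : nat) (f : 'rV[R]_n -> 'rV[R]_m) (E : set 'rV[R]_n),
    convex_body L -> K `<=` L ->
    admissible_weight mu -> (forall j, (1 <= j)%N -> j%:R <= mu j) ->
    weight_extension mu mut ->
    0 < b0 -> b0 < M0 -> (1 <= m)%N ->
    admissible_tuple mu (m%:R * M0) (a_const K d) b0 ->
    let N := degree mu (m%:R * M0) (a_const K d) b0 in
    smooth mu N M0 L f ->
    b0 <= sup_norm K f ->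
    lebesgue_measurable E -> E `<=` K -> (0 < lebesgue_rV E)%E ->
    let vK := fine (lebesgue_rV K) in
    let vE := fine (lebesgue_rV E) in
    sup_norm K f <=
      CN mut N * (m%:R * vK `^ nu / (vK `^ nu - (vK - vE) `^ nu)) ^+ N *
      sup_norm E f.

(* nu is an admissible choice of the constant nu_K. It depends on K alone, not
   on the extensions mut of the weights, over which [remez_inequality]
   therefore quantifies. *)
Definition remez_exponent (K : set 'rV[R]_n) (d : nat) (nu : R) : Prop :=
  [/\ 0 < nu <= 1, convex_body K -> nu = n%:R^-1 & remez_inequality K d nu].

End AdmissibleSets.

(* Main.v *)
(* Choose a median l of |f| on K: both {|f| <= l} and {|f| >= l} fill at least
   half of K, up to an arbitrarily small perturbation of l.  The Remez inequality
   for f on the first set bounds max_K |f| by a multiple of l, and for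
   g = M0 m0 / f on the second set it bounds l by the same multiple of
   min_K |f|; a half-measure set E has |K|^nu / (|K|^nu - (|K| - |E|)^nu) at most
   2^nu / (2^nu - 1).  Both applications use the weight beta0 mu, which turns
   a_K beta0 into a_K in the degree and leaves C_N unchanged.  That g is smooth
   for this weight follows from Leibniz' formula for f g = M0 m0: the numbers
   u_j = sum_{|alpha| = j} |d^alpha f| / alpha! satisfy
   |f| u_j(g) <= sum_{1 <= k <= j} u_k(f) u_{j-k}(g), and the hypothesis on
   (mu_1 ... mu_j / j!)^(1/j) lets this recursion be solved geometrically.

   The Remez inequality says nothing when |K| = 0, so one also needs |K| > 0.
   A map Phi with |x - y| <= C |Phi x - Phi y| + D |x - y|^2 pulls null sets back
   to null sets.  This applies to the root map and to R_w where its Jacobian is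
   bounded away from 0, the zeros of the Jacobian being null; as |K_w| > 0, the
   set K, which contains Upsilon_w(K_w), is not null. *)

Require Import Defs.
From HB Require Import structures.
From mathcomp Require Import all_boot all_order all_algebra.
From mathcomp Require Import all_classical all_reals all_analysis.
From mathcomp Require Import -(notations) mpoly.
From mathcomp Require Import ring lra.

Set Implicit Arguments.
Unset Strict Implicit.
Unset Printing Implicit Defensive.

Import Order.TTheory GRing.Theory Num.Theory.
Import numFieldNormedType.Exports.

Local Open Scope classical_set_scope.
Local Open Scope ring_scope.

(** * Lebesgue outer measure *)

Section OuterMeasure.
Variables (R : realType) (n : nat).
Implicit Types (A X : set 'rV[R]_n.+1) (a b : 'rV[R]_n.+1).

Definition box_cover X
    (c : (nat -> 'rV[R]_n.+1) * (nat -> 'rV[R]_n.+1)) : Prop :=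
  (forall k i, c.1 k 0 i <= c.2 k 0 i) /\
  X `<=` \bigcup_k box (c.1 k) (c.2 k).

Lemma box_volume_ge0 a b : (forall i, a 0 i <= b 0 i) -> 0 <= box_volume a b.
Proof. by move=> ab; apply: prodr_ge0 => i _; rewrite subr_ge0. Qed.

Lemma lebesgue_rV_le_cover X c : box_cover X c ->
  (lebesgue_rV X <= \sum_(k <oo) (box_volume (c.1 k) (c.2 k))%:E)%E.
Proof. by move=> Xc; apply: ereal_inf_lbound; exists c. Qed.

Lemma lebesgue_rV_lt_cover X y : (lebesgue_rV X < y)%E ->
  exists2 c, box_cover X c &
    (\sum_(k <oo) (box_volume (c.1 k) (c.2 k))%:E < y)%E.
Proof. by move=> /ereal_inf_ltP[_ [c Xc <-] cy]; exists c. Qed.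

Lemma lebesgue_rV_ge0 X : (0 <= lebesgue_rV X)%E.
Proof.
apply: le_ereal_inf_tmp => _ [c [c12 _] <-]; apply: nneseries_ge0 => k _ _.
by rewrite lee_fin box_volume_ge0.
Qed.

Lemma le_lebesgue_rV :
  {homo @lebesgue_rV R n.+1 : A X / A `<=` X >-> (A <= X)%E}.
Proof.
move=> A X AX; apply: ereal_inf_le_tmp => _ [c [c12 Xc] <-]; exists c => //.
by split=> //; exact: subset_trans Xc.
Qed.

Lemma lebesgue_rV_box a b : (forall i, a 0 i <= b 0 i) ->
  (lebesgue_rV (box a b) <= (box_volume a b)%:E)%E.
Proof.
move=> ab.
pose c : (nat -> 'rV[R]_n.+1) * (nat -> 'rV[R]_n.+1) :=
  ((fun k => a), (fun k => if k is 0%N then b else a)).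
have c12 k i : c.1 k 0 i <= c.2 k 0 i by case: k => [|k] /=.
have /lebesgue_rV_le_cover/le_trans : box_cover (box a b) c.
  by split=> // x ?; exists 0%N.
apply; rewrite nneseries_recl//; last first.
  by move=> k _; rewrite lee_fin box_volume_ge0.
rewrite eseries0 ?adde0// => -[|k]// _ _ /=.
by rewrite /box_volume big_ord_recl subrr mul0r.
Qed.

Lemma lebesgue_rV_set0 : lebesgue_rV (set0 : set 'rV[R]_n.+1) = 0%E.
Proof.
apply/eqP; rewrite eq_le lebesgue_rV_ge0 andbT.
apply: (@le_trans _ _ (lebesgue_rV (box 0 (0 : 'rV[R]_n.+1)))).
  exact: le_lebesgue_rV.
rewrite (le_trans (lebesgue_rV_box _))// lee_fin /box_volume.
by rewrite big_ord_recl subrr mul0r.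
Qed.

Lemma lebesgue_rV_sigma_subadditive : sigma_subadditive (@lebesgue_rV R n.+1).
Proof.
move=> A; have [[i Aioo]|Afin] := pselect (exists i, lebesgue_rV (A i) = +oo%E).
  rewrite (eseries_pinfty _ _ Aioo) ?leey// => j _.
  by rewrite -ltNye (lt_le_trans _ (lebesgue_rV_ge0 _)).
apply/lee_addgt0Pr => e e0.
apply: le_trans (epsilon_trick xpredT (fun=> lebesgue_rV_ge0 _) (ltW e0)).
have /choice[c cP] i : exists c, box_cover (A i) c /\
    (\sum_(k <oo) (box_volume (c.1 k) (c.2 k))%:E <=
       lebesgue_rV (A i) + (e / (2 ^ i.+1)%:R)%:E)%E.
  have /lebesgue_rV_lt_cover[c Ac cA] :
      (lebesgue_rV (A i) < lebesgue_rV (A i) + (e / (2 ^ i.+1)%:R)%:E)%E.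
    rewrite lteDl ?lte_fin ?divr_gt0// ge0_fin_numE ?lebesgue_rV_ge0//.
    by rewrite ltey; apply/eqP => Aioo; apply: Afin; exists i.
  by exists c; split=> //; exact: ltW.
have [f fbij] : exists f, set_bij [set: nat] [set: nat * nat] f.
  exact/card_set_bijP/card_esym/card_nat2.
pose c' : (nat -> 'rV[R]_n.+1) * (nat -> 'rV[R]_n.+1) :=
  ((fun k => (c (f k).1).1 (f k).2), (fun k => (c (f k).1).2 (f k).2)).
have c_ge0 i j : (0 <= (box_volume ((c i).1 j) ((c i).2 j))%:E)%E.
  by rewrite lee_fin box_volume_ge0// => l; exact: (cP i).1.1.
have /lebesgue_rV_le_cover/le_trans : box_cover (\bigcup_i A i) c'.
  split=> [k l|x [i _ /((cP i).1.2)[j _ xij]]]; first exact: (cP (f k).1).1.1.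
  have [_ _ /(_ (i, j) Logic.I)[k _ fk]] := fbij.
  by exists k; rewrite //= fk.
apply.
rewrite nneseries_esumT => [|k]; last exact: c_ge0.
rewrite -(reindex_esum [set: nat] [set: nat * nat] f
  (fun p => (box_volume ((c p.1).1 p.2) ((c p.1).2 p.2))%:E))//.
have -> : [set: nat * nat] = [set: nat] `*`` (fun=> [set: nat]).
  by apply/seteqP; split.
rewrite -(esum_esum
  (a := fun i j => (box_volume ((c i).1 j) ((c i).2 j))%:E))//.
rewrite -nneseries_esumT => [|i]; last by apply: esum_ge0.
apply: lee_nneseries => [i _ _|i _]; first by apply: esum_ge0.
by rewrite -nneseries_esumT //; exact: (cP i).2.
Qed.

HB.instance Definition _ := isOuterMeasure.Build R 'rV[R]_n.+1
  (@lebesgue_rV R n.+1) lebesgue_rV_set0 lebesgue_rV_ge0 le_lebesgue_rV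
  lebesgue_rV_sigma_subadditive.

End OuterMeasure.

Lemma ler_norm_coord (R : realType) (n : nat) (x : 'rV[R]_n) i :
  `|x 0 i| <= `|x|.
Proof.
rewrite [leRHS]mx_normrE.
exact: (le_bigmax_cond _ (fun ij : 'I_1 * 'I_n => `|x ij.1 ij.2|)
  (j := (0, i))).
Qed.

Lemma ger_norm_coord (R : realType) (n : nat) (x : 'rV[R]_n) (e : R) :
  0 <= e -> (forall i, `|x 0 i| <= e) -> `|x| <= e.
Proof.
move=> e0 xe; rewrite [leLHS]mx_normrE; apply/bigmax_leP; split=> // -[i j] _.
by rewrite (ord1 i).
Qed.

Section Caratheodory.
Variables (R : realType) (n : nat).
Implicit Types (A X : set 'rV[R]_n.+1) (a b x : 'rV[R]_n.+1).

Lemma lebesgue_measurable_bigcup (I : countType) (F : I -> set 'rV[R]_n.+1) :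
  (forall i, lebesgue_measurable (F i)) ->
  lebesgue_measurable (\bigcup_i F i).
Proof.
move=> mF.
have -> : \bigcup_i F i =
    \bigcup_k (if unpickle k is Some i then F i else set0).
  apply/seteqP; split=> [x [i _ Fix]|x [k _]]; last first.
    by case: unpickle => // i Fix; exists i.
  by exists (pickle i); rewrite //= pickleK.
apply: caratheodory_measurable_bigcup => k; case: unpickle => [i|].
  exact: mF.
exact: caratheodory_measurable_set0.
Qed.

Lemma box_volume_split a b i t :
  box_volume a (update b i t) + box_volume (update a i t) b = box_volume a b.
Proof.
pose P := \prod_(j < n.+1 | j != i) (b 0 j - a 0 j).
have -> : box_volume a b = (b 0 i - a 0 i) * P by rewrite /box_volume (bigD1 i).
have -> : box_volume a (update b i t) = (t - a 0 i) * P.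
  rewrite /box_volume (bigD1 i)//= mxE eqxx; congr (_ * _).
  by apply: eq_bigr => j /negbTE ji; rewrite mxE ji.
have -> : box_volume (update a i t) b = (b 0 i - t) * P.
  rewrite /box_volume (bigD1 i)//= mxE eqxx; congr (_ * _).
  by apply: eq_bigr => j /negbTE ji; rewrite mxE ji.
by rewrite -mulrDl addrC addrA subrK.
Qed.

Lemma lebesgue_measurable_halfspace (i : 'I_n.+1) (t : R) :
  lebesgue_measurable [set x : 'rV[R]_n.+1 | x 0 i <= t].
Proof.
apply: le_caratheodory_measurable => X.
apply: le_ereal_inf_tmp => _ [c [c12 Xc] <-].
pose s k : R := Num.max (c.1 k 0 i) (Num.min (c.2 k 0 i) t).
have s1 k : c.1 k 0 i <= s k by rewrite le_max lexx.
have s2 k : s k <= c.2 k 0 i by rewrite ge_max c12 ge_min lexx.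
pose l : (nat -> 'rV[R]_n.+1) * (nat -> 'rV[R]_n.+1) :=
  (c.1, fun k => update (c.2 k) i (s k)).
pose r : (nat -> 'rV[R]_n.+1) * (nat -> 'rV[R]_n.+1) :=
  ((fun k => update (c.1 k) i (s k)), c.2).
have l_le k j : l.1 k 0 j <= l.2 k 0 j.
  by rewrite /= mxE; case: eqP => [->|_]; [exact: s1|exact: c12].
have r_le k j : r.1 k 0 j <= r.2 k 0 j.
  by rewrite /= mxE; case: eqP => [->|_]; [exact: s2|exact: c12].
have lX : box_cover (X `&` [set x : 'rV[R]_n.+1 | x 0 i <= t]) l.
  split=> // x [/Xc[k _ xk] /= xt]; exists k => // j /=.
  have /andP[x1 x2] := xk j; rewrite x1 mxE; case: eqP => // ji.
  by rewrite /s le_max; apply/orP; right; rewrite le_min -ji x2 ji.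
have rX : box_cover (X `&` ~` [set x : 'rV[R]_n.+1 | x 0 i <= t]) r.
  split=> // x [/Xc[k _ xk] /= /negP]; rewrite -ltNge => xt.
  exists k => // j /=.
  have /andP[x1 x2] := xk j; rewrite x2 mxE andbT; case: eqP => // ji.
  by rewrite /s ge_max -ji x1/= ge_min; apply/orP; right; rewrite ji ltW.
apply: le_trans (leeD (lebesgue_rV_le_cover lX) (lebesgue_rV_le_cover rX)) _.
rewrite -nneseriesD; last 2 first.
- by move=> k _ _; rewrite lee_fin box_volume_ge0.
- by move=> k _ _; rewrite lee_fin box_volume_ge0.
rewrite le_eqVlt; apply/orP; left; apply/eqP; apply: eq_eseriesr => k _ /=.
by rewrite -EFinD box_volume_split.
Qed.

Lemma lebesgue_measurable_cell a b :
  lebesgue_measurable [set x : 'rV[R]_n.+1 | forall i, a 0 i < x 0 i <= b 0 i].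
Proof.
have -> : [set x : 'rV[R]_n.+1 | forall i, a 0 i < x 0 i <= b 0 i] =
    ~` \bigcup_i ~` ([set x : 'rV[R]_n.+1 | x 0 i <= b 0 i] `\`
                     [set x : 'rV[R]_n.+1 | x 0 i <= a 0 i]).
  apply/seteqP; split=> [x xab [i _]|x xab i].
    by apply; split; have /andP[x1 x2] //= := xab i; rewrite leNgt x1.
  apply: contrapT => xi; apply: xab; exists i => //= -[xb xa].
  by apply: xi; rewrite xb ltNge andbT; exact/negP.
apply/caratheodory_measurable_setC/lebesgue_measurable_bigcup => i.
apply/caratheodory_measurable_setC/caratheodory_measurable_setD;
  exact: lebesgue_measurable_halfspace.
Qed.

Lemma lebesgue_measurable_open A : open A -> lebesgue_measurable A.
Proof.
move=> oA.
pose cell (p : nat * {ffun 'I_n.+1 -> int}) : set 'rV[R]_n.+1 :=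
  [set x : 'rV[R]_n.+1 | forall i,
    (\row_i ((p.2 i)%:~R / p.1.+1%:R) : 'rV[R]_n.+1) 0 i < x 0 i
      <= (\row_i (((p.2 i)%:~R + 1) / p.1.+1%:R) : 'rV[R]_n.+1) 0 i].
have -> : A = \bigcup_p (if `[< cell p `<=` A >] then cell p else set0).
  apply/seteqP; split=> [x Ax|x [p _]]; last by case: asboolP => // + xp; apply.
  have /nbhs_ballP[e /= e0 xeA] : nbhs x A by exact: open_nbhs_nbhs.
  have [k ke] : exists k, (k.+1%:R)^-1 < e.
    exists (Num.truncn e^-1).
    by rewrite invf_plt ?posrE// truncnS_gt.
  pose z : {ffun 'I_n.+1 -> int} :=
    [ffun i => Num.ceil (x 0 i * k.+1%:R) - 1].
  have zx : cell (k, z) x.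
    move=> i; rewrite !mxE /= ffunE; apply/andP; split.
      rewrite ltr_pdivrMr//.
      by have /andP[] := Num.Theory.real_ceil_itv (num_real (x 0 i * k.+1%:R)).
    rewrite ler_pdivlMr// intrB subrK.
    by have /andP[] := Num.Theory.real_ceil_itv (num_real (x 0 i * k.+1%:R)).
  exists (k, z) => //; case: asboolP => // -[] y zy; apply: xeA.
  split=> // i j; rewrite (ord1 i) /ball/= ltr_distlC.
  have := zx j; have := zy j; rewrite !mxE/= => /andP[y1 y2] /andP[x1 x2].
  have E : ((z j)%:~R + 1) / k.+1%:R = (z j)%:~R / k.+1%:R + k.+1%:R^-1 :> R.
    by rewrite mulrDl mul1r.
  rewrite E in y2 x2; move: ke x1 x2 y1 y2; set h := k.+1%:R^-1; set c := _ * h.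
  by move=> *; apply/andP; split; lra.
apply: lebesgue_measurable_bigcup => p; case: asboolP => _.
  exact: lebesgue_measurable_cell.
exact: caratheodory_measurable_set0.
Qed.

Lemma lebesgue_measurable_closed A : closed A -> lebesgue_measurable A.
Proof.
move=> cA; rewrite -(setCK A); apply: caratheodory_measurable_setC.
by apply: lebesgue_measurable_open; rewrite openC.
Qed.

Lemma compact_sub_box A : compact A ->
  exists2 M : R, 0 < M & A `<=` box (const_mx (- M)) (const_mx M).
Proof.
move=> /compact_bounded[M [_ AM]].
exists (`|M| + 1); first by rewrite ltr_pwDr.
move=> x Ax i; have /AM/(_ x Ax) : M < `|M| + 1.
  by rewrite (le_lt_trans (ler_norm _))// ltrDl.
move=> xM; rewrite !mxE -ler_norml; apply: le_trans xM.
exact: ler_norm_coord.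
Qed.

Lemma lebesgue_rV_compact_lty A : compact A -> (lebesgue_rV A < +oo)%E.
Proof.
move=> /compact_sub_box[M M0 /le_lebesgue_rV/le_lt_trans]; apply.
apply: le_lt_trans (lebesgue_rV_box _) (ltry _) => i; rewrite !mxE.
by rewrite (le_trans (y := 0))// ?oppr_le0 ltW.
Qed.

End Caratheodory.

(** * Null sets and expanding maps *)

Section NullSets.
Variables (R : realType) (n : nat).
Implicit Types (A B : set 'rV[R]_n.+1) (a b x y : 'rV[R]_n.+1).

Lemma sub_null A B : A `<=` B -> lebesgue_rV B = 0%E -> lebesgue_rV A = 0%E.
Proof.
move=> AB B0; apply/eqP; rewrite eq_le lebesgue_rV_ge0 andbT -B0.
exact: le_lebesgue_rV.
Qed.

Lemma bigcup_null (I : countType) (F : I -> set 'rV[R]_n.+1) :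
  (forall i, lebesgue_rV (F i) = 0%E) -> lebesgue_rV (\bigcup_i F i) = 0%E.
Proof.
move=> F0; pose G k := if unpickle k is Some i then F i else set0.
apply: (@sub_null _ (\bigcup_k G k)).
  by move=> x [i _ Fix]; exists (pickle i); rewrite /G//= pickleK.
apply/eqP; rewrite eq_le lebesgue_rV_ge0 andbT.
apply: le_trans (lebesgue_rV_sigma_subadditive _) _.
rewrite eseries0// => k _ _; rewrite /G; case: unpickle => [i|]; first exact: F0.
exact: lebesgue_rV_set0.
Qed.

Lemma setU_null A B :
  lebesgue_rV A = 0%E -> lebesgue_rV B = 0%E -> lebesgue_rV (A `|` B) = 0%E.
Proof.
move=> A0 B0; apply/eqP; rewrite eq_le lebesgue_rV_ge0 andbT.
apply: le_trans (outer_measureU2 _ A B) _.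
by rewrite [X in (X + _)%E]A0 [X in (_ + X)%E]B0 adde0.
Qed.

Lemma lebesgue_rV_fin_bigcup (I : finType) (P : pred I)
    (F : I -> set 'rV[R]_n.+1) :
  (lebesgue_rV (\bigcup_(i in [set i | P i]) F i) <=
   \sum_(i | P i) lebesgue_rV (F i))%E.
Proof.
apply: (@le_trans _ _ (lebesgue_rV (\big[setU/set0]_(i | P i) F i))).
  by apply: le_lebesgue_rV => x [i Pi Fix]; rewrite (bigD1 i)//=; left.
elim/big_rec2: _ => [|i y B _ yB]; first by rewrite lebesgue_rV_set0.
by apply: le_trans (outer_measureU2 _ _ _) _; apply: leeD.
Qed.

Lemma lebesgue_rV_small A r : 0 <= r ->
  (forall x y, A x -> A y -> `|x - y| <= r) ->
  (lebesgue_rV A <= ((2 * r) ^+ n.+1)%:E)%E.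
Proof.
move=> r0 Ar; have [->|/set0P[x Ax]] := eqVneq A set0.
  by rewrite lebesgue_rV_set0 lee_fin exprn_ge0// mulr_ge0.
apply: (@le_trans _ _
    (lebesgue_rV (box (x - const_mx r) (x + const_mx r)))).
  apply: le_lebesgue_rV => y Ay i; rewrite !mxE -ler_distl.
  by rewrite (le_trans _ (Ar _ _ Ay Ax))//;
    have := ler_norm_coord (y - x) i; rewrite !mxE.
apply: le_trans (lebesgue_rV_box _) _ => [i|].
  by rewrite !mxE lerD2l; lra.
rewrite lee_fin /box_volume.
under eq_bigr => i _.
  have -> : (x + const_mx r) 0 i - (x - const_mx r) 0 i = 2 * r.
    by rewrite !mxE; lra.
  over.
by rewrite prodr_const card_ord.
Qed.

(* The box is cut into cells of side at most [s], which are pulled back. *)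
Lemma lebesgue_rV_preimage_box A (Phi : 'rV[R]_n.+1 -> 'rV[R]_n.+1) C a b s :
  0 <= C -> 0 < s -> (forall i, a 0 i <= b 0 i) ->
  (forall x y, A x -> A y -> `|x - y| <= C * `|Phi x - Phi y|) ->
  (lebesgue_rV (A `&` Phi @^-1` box a b) <=
     ((2 * C) ^+ n.+1 * \prod_i (b 0 i - a 0 i + s))%:E)%E.
Proof.
move=> C0 s0 ab AC.
pose m i := Num.truncn ((b 0 i - a 0 i) / s).
pose M := (\max_i m i)%N.
pose cell (z : {ffun 'I_n.+1 -> 'I_M.+1}) := A `&` [set x |
  forall i, (z i : nat)%:R * s <= Phi x 0 i - a 0 i <= (z i).+1%:R * s].
pose Q i : pred 'I_M.+1 := [pred k : 'I_M.+1 | (k <= m i)%N].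
apply: (@le_trans _ _
    (lebesgue_rV (\bigcup_(z in [set z | z \in family Q]) cell z))).
  apply: le_lebesgue_rV => x [Ax xab].
  pose k i := Num.truncn ((Phi x 0 i - a 0 i) / s).
  have k_m i : (k i <= m i)%N.
    by apply: le_truncn; rewrite ler_pM2r ?invr_gt0// lerD2r;
      have /andP[] := xab i.
  have k_M i : (k i < M.+1)%N.
    by rewrite ltnS (leq_trans (k_m i))//; exact: leq_bigmax.
  exists [ffun i => Ordinal (k_M i)] => /=.
    by apply/familyP => i; rewrite ffunE inE /= k_m.
  split=> // i; rewrite ffunE /=.
  have /andP[xa xb] := xab i.
  have /truncn_itv/andP[k1 k2] : 0 <= (Phi x 0 i - a 0 i) / s.
    by rewrite divr_ge0 ?subr_ge0// ltW.
  by rewrite -ler_pdivlMr// k1 -ler_pdivrMr// ltW.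
apply: le_trans (lebesgue_rV_fin_bigcup _ _) _.
apply: (@le_trans _ _
    (\sum_(z in family Q) (\prod_(i < n.+1) (2 * (C * s)))%:E)%E).
  apply: lee_sum => z _; rewrite prodr_const card_ord.
  apply: lebesgue_rV_small => [|x y [Ax xz] [Ay yz]].
    by rewrite mulr_ge0// ltW.
  rewrite (le_trans (AC _ _ Ax Ay))// ler_wpM2l//.
  apply: ger_norm_coord => [|i]; first exact: ltW.
  have := xz i; have := yz i; rewrite !mxE -natr1 mulrDl mul1r.
  move=> /andP[y1 y2] /andP[x1 x2].
  by rewrite ler_norml; apply/andP; split; lra.
rewrite sumEFin lee_fin -(bigA_distr_big_dep Q (fun _ _ => 2 * (C * s))).
have -> : (2 * C) ^+ n.+1 * \prod_i (b 0 i - a 0 i + s) =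
    \prod_i (2 * C * (b 0 i - a 0 i + s)).
  by rewrite big_split/= prodr_const card_ord.
apply: ler_prod => i _; rewrite sumr_const.
rewrite mulrn_wge0 ?mulr_ge0//=; last exact: ltW.
have -> : #|[pred j | Q i j]| = (m i).+1.
  rewrite -[RHS](card_ord (m i).+1).
  have mM : ((m i).+1 <= M.+1)%N by rewrite ltnS; exact: leq_bigmax.
  have widen_inj : injective (widen_ord mM).
    by move=> j k /(congr1 val)/= /val_inj.
  rewrite -(card_imset _ widen_inj); apply: eq_card => k.
  rewrite inE /=; apply/idP/imsetP => [km|[j _ ->]]; last first.
    exact: (ltn_ord j).
  by exists (Ordinal (km : (k < (m i).+1)%N)) => //; exact: val_inj.
have -> : 2 * (C * s) *+ (m i).+1 = 2 * C * ((m i)%:R * s + s).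
  by rewrite -(mulr_natr _ (m i).+1) -(natr1 (m i)); ring.
rewrite ler_wpM2l ?mulr_ge0// lerD2r -ler_pdivlMr//.
have /truncn_itv/andP[] // : 0 <= (b 0 i - a 0 i) / s.
by rewrite divr_ge0 ?subr_ge0// ltW.
Qed.

Lemma null_expanding A (Phi : 'rV[R]_n.+1 -> 'rV[R]_n.+1) C :
  0 <= C ->
  (forall x y, A x -> A y -> `|x - y| <= C * `|Phi x - Phi y|) ->
  lebesgue_rV (Phi @` A) = 0%E -> lebesgue_rV A = 0%E.
Proof.
move=> C0 AC PhiA0; pose K := (2 * C) ^+ n.+1.
have K0 : 0 <= K by rewrite exprn_ge0// mulr_ge0.
have preimage_box a b : (forall i, a 0 i <= b 0 i) ->
    (lebesgue_rV (A `&` Phi @^-1` box a b) <= (K * box_volume a b)%:E)%E.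
  move=> ab; pose p : {poly R} := \prod_i ((b 0 i - a 0 i)%:P + 'X).
  have pE s : p.[s] = \prod_i (b 0 i - a 0 i + s).
    by rewrite /p horner_prod; apply: eq_bigr => i _; rewrite !hornerE.
  have -> : box_volume a b = p.[0].
    by rewrite pE; apply: eq_bigr => i _; rewrite addr0.
  have pc : (K%:E * (p.[s])%:E)%E @[s --> 0^'+] --> (K%:E * (p.[0])%:E)%E.
    apply: cvgeZl => //; apply: cvg_EFin; first by near=> s.
    by apply: cvg_at_right_filter; exact: continuous_horner.
  rewrite EFinM -(cvg_lim _ pc)//; apply: lime_ge.
    by apply/cvg_ex; eexists; exact: pc.
  near=> s; rewrite -EFinM pE; apply: lebesgue_rV_preimage_box => //.
apply/eqP; rewrite eq_le lebesgue_rV_ge0 andbT; apply/lee_addgt0Pr => e e0.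
rewrite add0e.
have d0 : 0 < e / (K + 1) by rewrite divr_gt0// ltr_wpDl.
have /lebesgue_rV_lt_cover[c [c12 Ac] ce] :
  (lebesgue_rV (Phi @` A) < (e / (K + 1))%:E)%E by rewrite PhiA0 lte_fin.
apply: (@le_trans _ _
    (lebesgue_rV (\bigcup_k (A `&` Phi @^-1` box (c.1 k) (c.2 k))))).
  apply: le_lebesgue_rV => x Ax.
  have [k _ xk] : (\bigcup_k box (c.1 k) (c.2 k)) (Phi x).
    by apply: Ac; exists x.
  by exists k.
apply: le_trans (lebesgue_rV_sigma_subadditive _) _.
apply: (@le_trans _ _
    (\sum_(k <oo) (K%:E * (box_volume (c.1 k) (c.2 k))%:E))%E).
  apply: lee_nneseries => [k _ _|k _]; first exact: lebesgue_rV_ge0.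
  by rewrite -EFinM; exact: preimage_box.
rewrite nneseriesZl//; last by move=> k _; rewrite lee_fin box_volume_ge0.
apply: (@le_trans _ _ (K%:E * (e / (K + 1))%:E)%E).
  by rewrite lee_wpmul2l ?lee_fin//; exact: ltW.
rewrite -EFinM lee_fin mulrA ler_pdivrMr ?ltr_wpDl// mulrC ler_wpM2l ?ltW//.
by rewrite ltrDl.
Unshelve. all: by end_near. Qed.

(* On pieces of diameter at most [1 / (2 D)] the quadratic term is absorbed. *)
Lemma null_quadratic_expanding A (Phi : 'rV[R]_n.+1 -> 'rV[R]_n.+1) C D :
  0 <= C -> 0 <= D ->
  (forall x y, A x -> A y ->
     `|x - y| <= C * `|Phi x - Phi y| + D * `|x - y| ^+ 2) ->
  lebesgue_rV (Phi @` A) = 0%E -> lebesgue_rV A = 0%E.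
Proof.
move=> C0 D0 ACD PhiA0; pose s := (2 * (D + 1))^-1.
have s0 : 0 < s by rewrite invr_gt0 mulr_gt0// ltr_wpDl.
pose cell (z : {ffun 'I_n.+1 -> int}) := A `&` [set x |
  forall i, (z i)%:~R * s <= x 0 i < ((z i)%:~R + 1) * s].
apply: (@sub_null _ (\bigcup_z cell z)).
  move=> x Ax; exists [ffun i => Num.floor (x 0 i / s)] => //; split=> // i.
  rewrite ffunE -ler_pdivlMr// -ltr_pdivrMr//.
  by have := real_floor_itv (num_real (x 0 i / s)); rewrite intrD.
apply: bigcup_null => z.
apply: (@null_expanding _ Phi (2 * C)); first by rewrite mulr_ge0.
  move=> x y [Ax xz] [Ay yz].
  have xy : `|x - y| <= s.
    apply: ger_norm_coord => [|i]; first exact: ltW.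
    have := xz i; have := yz i; rewrite !mxE mulrDl mul1r.
    move=> /andP[y1 y2] /andP[x1 x2].
    by rewrite ler_norml; apply/andP; split; lra.
  have : D * `|x - y| ^+ 2 <= `|x - y| / 2.
    rewrite expr2 mulrA mulrC ler_wpM2l//.
    apply: (@le_trans _ _ (D * s)); first exact: ler_wpM2l.
    rewrite /s invfM mulrCA ler_pdivrMl// divff// ler_pdivrMr ?ltr_wpDl//.
    by rewrite mul1r ltW// ltrDl.
  by have := ACD x y Ax Ay; lra.
by apply: sub_null PhiA0; apply: image_subset => x [].
Qed.

End NullSets.

(** * Polynomials on the unit cube *)

Section PolynomialsOnTheCube.
Variables (R : realType) (n : nat).
Implicit Types (p q : mpoly n R) (x y : 'rV[R]_n).

Definition unit_cube : set 'rV[R]_n := [set x | forall i, 0 <= x 0 i <= 1].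

Definition eval p x : R := meval (fun i => x 0 i) p.

Definition eval_diff p y (v : 'rV[R]_n) : R :=
  \sum_i eval (mderiv i p) y * v 0 i.

Definition taylor_bound p (C : R) : Prop :=
  forall x y, unit_cube x -> unit_cube y ->
    [/\ `|eval p x| <= C, `|eval p x - eval p y| <= C * `|x - y| &
        `|eval p x - eval p y - eval_diff p y (x - y)| <= C * `|x - y| ^+ 2].

Lemma taylor_bound_le p C C' : C <= C' -> taylor_bound p C -> taylor_bound p C'.
Proof.
move=> CC' pC x y x01 y01; have [p0 p1 p2] := pC x y x01 y01; split.
- exact: le_trans CC'.
- by rewrite (le_trans p1)// ler_wpM2r.
- by rewrite (le_trans p2)// ler_wpM2r// exprn_ge0.
Qed.

Lemma taylor_bound_const (c : R) : taylor_bound (mpolyC n c) `|c|.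
Proof.
move=> x y _ _; rewrite /eval_diff/eval !mevalC subrr normr0 sub0r.
rewrite big1 ?oppr0 ?normr0; last by move=> i _; rewrite mderivC meval0 mul0r.
by split=> //; rewrite mulr_ge0.
Qed.

Lemma taylor_bound_var (i : 'I_n) : taylor_bound (mpolyX R (mnm1 i)) 1.
Proof.
move=> x y x01 y01.
have -> : eval_diff (mpolyX R (mnm1 i)) y (x - y) = x 0 i - y 0 i.
  rewrite /eval_diff (bigD1 i)//= big1 ?addr0 => [|j ji].
    by rewrite mderivX mnm1E eqxx scale1r /eval mevalX big1 ?mul1r ?mxE// => k _;
      rewrite mnmBE subnn expr0.
  by rewrite mderivX mnm1E eq_sym (negbTE ji) scale0r /eval meval0 mul0r.
rewrite /eval !mevalXU subrr normr0 !mul1r; split.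
- by have /andP[x0 x1] := x01 i; rewrite ger0_norm.
- by have := ler_norm_coord (x - y) i; rewrite !mxE.
- by rewrite exprn_ge0.
Qed.

Lemma taylor_boundD p q C D :
  taylor_bound p C -> taylor_bound q D -> taylor_bound (p + q) (C + D).
Proof.
move=> pC qD x y x01 y01.
have [p0 p1 p2] := pC x y x01 y01; have [q0 q1 q2] := qD x y x01 y01.
have -> : eval_diff (p + q) y (x - y) =
    eval_diff p y (x - y) + eval_diff q y (x - y).
  rewrite /eval_diff -big_split; apply: eq_bigr => i _.
  by rewrite /eval mderivD mevalD mulrDl.
rewrite /eval !mevalD -!/(eval _ _) !mulrDl; split.
- by rewrite (le_trans (ler_normD _ _))// lerD.
- by rewrite opprD addrACA (le_trans (ler_normD _ _))// lerD.
- apply: le_trans (lerD p2 q2); apply: le_trans (ler_normD _ _).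
  by rewrite le_eqVlt; apply/orP; left; apply/eqP; congr `|_|; ring.
Qed.

Lemma taylor_boundM p q C D :
  taylor_bound p C -> taylor_bound q D -> taylor_bound (p * q) (3 * (C * D)).
Proof.
move=> pC qD x y x01 y01.
have [p0 p1 p2] := pC x y x01 y01; have [q0 q1 q2] := qD x y x01 y01.
have [py _ _] := pC y y y01 y01; have [qy _ _] := qD y y y01 y01.
have C0 : 0 <= C := le_trans (normr_ge0 _) p0.
have D0 : 0 <= D := le_trans (normr_ge0 _) q0.
have CD0 : 0 <= C * D by rewrite mulr_ge0.
have -> : eval_diff (p * q) y (x - y) =
    eval_diff p y (x - y) * eval q y + eval p y * eval_diff q y (x - y).
  rewrite /eval_diff mulr_suml mulr_sumr -big_split; apply: eq_bigr => i _.
  by rewrite /eval mderivM mevalD !mevalM /=; ring.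
rewrite /eval !mevalM -!/(eval _ _).
set P := eval p x in p0 p1 p2 *; set Q := eval q x in q0 q1 q2 *.
set P' := eval p y in p1 p2 py *; set Q' := eval q y in q1 q2 qy *.
set dP := eval_diff p _ _ in p2 *; set dQ := eval_diff q _ _ in q2 *.
split.
- by rewrite normrM; have := ler_pM (normr_ge0 P) (normr_ge0 Q) p0 q0; lra.
- have -> : P * Q - P' * Q' = (P - P') * Q + P' * (Q - Q') by ring.
  rewrite (le_trans (ler_normD _ _))// !normrM.
  have := ler_pM (normr_ge0 _) (normr_ge0 _) p1 q0.
  have := ler_pM (normr_ge0 _) (normr_ge0 _) py q1.
  have := mulr_ge0 CD0 (normr_ge0 (x - y)).
  by lra.
- have -> : P * Q - P' * Q' - (dP * Q' + P' * dQ) =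
    (P - P' - dP) * Q' + P' * (Q - Q' - dQ) + (P - P') * (Q - Q') by ring.
  rewrite (le_trans (ler_normD _ _))// !normrM.
  have := ler_normD ((P - P' - dP) * Q') (P' * (Q - Q' - dQ)); rewrite !normrM.
  have := ler_pM (normr_ge0 _) (normr_ge0 _) p2 qy.
  have := ler_pM (normr_ge0 _) (normr_ge0 _) py q2.
  have := ler_pM (normr_ge0 _) (normr_ge0 _) p1 q1.
  by rewrite expr2; lra.
Qed.

Lemma taylor_bound_exists p : exists C, taylor_bound p C.
Proof.
elim/mpolyind: p => [|c m p _ _ [D pD]].
  by exists `|0 : R|; rewrite -(mpolyC0 n R); exact: taylor_bound_const.
suff [C mC] : exists C, taylor_bound (mpolyX R m) C.
  exists (3 * (`|c| * C) + D); apply: taylor_boundD pD.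
  by rewrite -mul_mpolyC; apply: taylor_boundM => //; exact: taylor_bound_const.
rewrite mpolyXE_id; apply: (@big_ind _ (fun p => exists C, taylor_bound p C)).
- by exists `|1 : R|; rewrite -(mpolyC1 n R); exact: taylor_bound_const.
- by move=> q r [C qC] [E rE]; exists (3 * (C * E)); exact: taylor_boundM.
move=> i _; elim: (m i) => [|k [C kC]].
  by exists `|1 : R|; rewrite expr0 -(mpolyC1 n R); exact: taylor_bound_const.
exists (3 * (1 * C)); rewrite exprS; apply: taylor_boundM => //.
exact: taylor_bound_var.
Qed.

Lemma taylor_bound_uniform (I : finType) (p : I -> mpoly n R) :
  exists2 C, 0 <= C & forall i, taylor_bound (p i) C.
Proof.
have /choice[C pC] i : exists C, taylor_bound (p i) C.
  exact: taylor_bound_exists.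
exists (\sum_i `|C i|) => [|i]; first exact: sumr_ge0.
apply: taylor_bound_le (pC i); rewrite (le_trans (ler_norm _))//.
by rewrite (bigD1 i)//= lerDl sumr_ge0.
Qed.

End PolynomialsOnTheCube.

Arguments unit_cube {R n}.

Section PolynomialNullSets.
Variables (R : realType) (n : nat).
Implicit Types (p q : mpoly n.+1 R) (x y : 'rV[R]_n.+1).

Lemma coord_plane_null (i : 'I_n.+1) :
  lebesgue_rV (@unit_cube R n.+1 `&` [set x | x 0 i = 0]) = 0%E.
Proof.
apply: (@sub_null _ _ _ (box 0 (\row_j (if j == i then 0 else 1)))).
  move=> x [x01 xi] j; rewrite !mxE; case: eqP => [->|_]; last exact: x01.
  by rewrite xi lexx.
apply/eqP; rewrite eq_le lebesgue_rV_ge0 andbT.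
apply: le_trans (lebesgue_rV_box _) _ => [j|].
  by rewrite !mxE; case: ifP.
by rewrite lee_fin /box_volume (bigD1 i)//= !mxE eqxx subrr mul0r.
Qed.

Lemma simple_zeros_null p (i : 'I_n.+1) (e : R) : 0 < e ->
  lebesgue_rV (@unit_cube R n.+1 `&`
    [set x | eval p x = 0 /\ e <= `|eval (mderiv i p) x|]) = 0%E.
Proof.
move=> e0; have [C pC] := taylor_bound_exists p.
have [D D0 dD] := taylor_bound_uniform (fun j => mderiv j p).
set A := (X in lebesgue_rV X).
have [->|/set0P[x0 [x01 _]]] := eqVneq A set0; first exact: lebesgue_rV_set0.
have C0 : 0 <= C by have [/(le_trans _) + _ _] := pC x0 x0 x01 x01; exact.
pose Phi x := update x i 0.
apply: (@null_quadratic_expanding _ _ _ Phi (1 + e^-1 * (D *+ n.+1)) (e^-1 * C)).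
- by rewrite addr_ge0// mulr_ge0 ?invr_ge0 ?mulrn_wge0// ltW.
- by rewrite mulr_ge0// invr_ge0 ltW.
- move=> x y [x1 [px _]] [y1 [py pye]].
  have Phi_coord j : j != i -> `|x 0 j - y 0 j| <= `|Phi x - Phi y|.
    move=> ji; have := ler_norm_coord (Phi x - Phi y) j.
    by rewrite !mxE (negbTE ji).
  have xyi : `|x 0 i - y 0 i| <=
      e^-1 * (D *+ n.+1) * `|Phi x - Phi y| + e^-1 * C * `|x - y| ^+ 2.
    rewrite -!mulrA -mulrDr mulrC ler_pdivlMr// mulrC.
    apply: (@le_trans _ _ (`|eval (mderiv i p) y| * `|x 0 i - y 0 i|)).
      exact: ler_wpM2r.
    have [_ _] := pC x y x1 y1; rewrite px py subrr sub0r normrN.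
    rewrite /eval_diff (bigD1 i)//=; set S := (X in _ + X); rewrite !mxE => pxy.
    have S_le : `|S| <= D *+ n.+1 * `|Phi x - Phi y|.
      apply: le_trans (ler_norm_sum _ _ _) _.
      apply: (@le_trans _ _ (\sum_(j < n.+1) D * `|Phi x - Phi y|)).
        rewrite [leRHS](bigD1 i)//= ler_wpDl ?mulr_ge0//; apply: ler_sum => j ji.
        rewrite normrM !mxE ler_pM//; last exact: Phi_coord.
        by have [] := dD j y y y1 y1.
      by rewrite sumr_const card_ord mulrnAl.
    rewrite -normrM -[X in `|X|](addrK S) (le_trans (ler_normB _ _))// addrC.
    exact: lerD.
  have xy : `|x - y| <= `|Phi x - Phi y| + `|x 0 i - y 0 i|.
    apply: ger_norm_coord => [|j]; first exact: addr_ge0.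
    rewrite !mxE; have [->|/Phi_coord] := eqVneq j i; first by rewrite lerDr.
    by move=> /le_trans; apply; rewrite lerDl.
  by apply: le_trans xy _; rewrite mulrDl mul1r -addrA lerD2l.
- apply: sub_null (coord_plane_null i) => _ [x [x1 _] <-].
  split=> [j|]; rewrite /Phi /= !mxE ?eqxx//.
  by case: eqP => // _; rewrite lexx ler01.
Qed.

Lemma zeros_null p : p != 0 ->
  lebesgue_rV (@unit_cube R n.+1 `&` [set x | eval p x = 0]) = 0%E.
Proof.
have [k] := ubnP (mmeasure (@mdeg n.+1) p); elim: k p => // k IHk p pk p0.
have [/existsP[i dp0]|/existsPn dp0] := boolP [exists i, mderiv i p != 0].
  have dpk : (mmeasure (@mdeg n.+1) (mderiv i p) < k)%N.
    rewrite ltnS in pk; apply: leq_trans pk.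
    have := mlead_supp dp0; rewrite mcoeff_msupp mcoeff_mderiv => c0.
    have /msize_mdeg_lt : mnm_add (mlead (mderiv i p)) (mnm1 i) \in msupp p.
      by rewrite mcoeff_msupp; apply: contraNneq c0 => ->; rewrite mul0rn.
    by rewrite mdegD mdeg1 addn1 mlead_deg.
  pose simple m : set 'rV[R]_n.+1 := unit_cube `&`
    [set x | eval p x = 0 /\ m.+1%:R^-1 <= `|eval (mderiv i p) x|].
  apply: (@sub_null _ _ _ ((unit_cube `&`
    [set x | eval (mderiv i p) x = 0]) `|` \bigcup_m simple m)).
    move=> x [x01 px]; have [dpx|dpx] := eqVneq (eval (mderiv i p) x) 0.
      by left.
    right; exists (Num.truncn `|eval (mderiv i p) x|^-1) => //.
    split=> //; split=> //.
    by rewrite invf_ple ?posrE ?normr_gt0// ltW// truncnS_gt.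
  apply: setU_null; first exact: IHk.
  by apply: bigcup_null => m; apply: simple_zeros_null; rewrite invr_gt0.
suff -> : unit_cube `&` [set x | eval p x = 0] = set0.
  exact: lebesgue_rV_set0.
have pC : p = mpolyC n.+1 (mcoeff mnm0 p).
  apply/mpolyP => m; rewrite mcoeffC.
  have [->|m0] := eqVneq m mnm0; first by rewrite mulr1.
  rewrite mulr0; have [i mi] : exists i, m i != 0%N.
    apply: contrapT => /forallNP mE; move/eqP: m0; apply; apply/mnmP => i.
    by rewrite mnm0E; apply/eqP/negPn/negP; exact: mE.
  have := mcoeff_mderiv i p (mnm_sub m (mnm1 i)).
  have /negPn/eqP -> := dp0 i; rewrite mcoeff0 submK ?lep1mP//.
  by move=> /esym/eqP; rewrite mulrn_eq0 => /eqP.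
rewrite -subset0 => x [_]; rewrite /= pC /eval mevalC => pm0; move: p0.
by rewrite pC pm0 mpolyC0 eqxx.
Qed.

End PolynomialNullSets.

(** * Admissible sets have positive measure *)

Section PositiveMeasure.
Variables (R : realType) (n : nat).
Implicit Types (A K : set 'rV[R]_n.+1) (x y : 'rV[R]_n.+1).

Lemma polymap_nonsingular_null (P : polymap R n.+1) A (e : R) : 0 < e ->
  A `<=` unit_cube -> (forall x, A x -> e <= `|eval (jac P) x|) ->
  lebesgue_rV (eval_polymap P @` A) = 0%E -> lebesgue_rV A = 0%E.
Proof.
move=> e0 A01 Ae.
have [C C0 PC] := taylor_bound_uniform P.
pose J := \matrix_(i, j) mderiv j (P i) : 'M[mpoly n.+1 R]_n.+1.
have [D D0 JD] := taylor_bound_uniform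
  (fun ij : 'I_n.+1 * 'I_n.+1 => (\adj J) ij.1 ij.2).
pose E := e^-1 * (D *+ n.+1).
have E0 : 0 <= E by rewrite mulr_ge0 ?invr_ge0 ?mulrn_wge0// ltW.
apply: (@null_quadratic_expanding _ _ _ _ E (E * C)) => //.
  exact: mulr_ge0.
move=> x y Ax Ay.
pose Jy := map_mx (meval (fun i => y 0 i)) J.
have detJy : \det Jy = eval (jac P) y by rewrite det_map_mx.
pose v : 'cV[R]_n.+1 := (x - y)^T.
have Jyv i : `|(Jy *m v) i 0| <=
    `|eval_polymap P x - eval_polymap P y| + C * `|x - y| ^+ 2.
  have -> : (Jy *m v) i 0 = eval_diff (P i) y (x - y).
    by rewrite mxE; apply: eq_bigr => j _; rewrite !mxE.
  have [_ _] := PC i x y (A01 _ Ax) (A01 _ Ay).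
  set p := eval (P i) x - eval (P i) y; rewrite distrC => pC.
  rewrite -[X in `|X|](subrK p) (le_trans (ler_normD _ _))// addrC lerD//.
  by have := ler_norm_coord (eval_polymap P x - eval_polymap P y) i; rewrite !mxE.
move: Jyv; set N := `|eval_polymap P x - _| => Jyv.
have -> : E * N + E * C * `|x - y| ^+ 2 =
    D *+ n.+1 * (N + C * `|x - y| ^+ 2) / e by rewrite /E; ring.
rewrite ler_pdivlMr// mulrC.
apply: (@le_trans _ _ (`|\det Jy| * `|x - y|)).
  by rewrite ler_wpM2r// detJy Ae.
rewrite -normrZ.
apply: ger_norm_coord => [|k].
  apply: mulr_ge0; first exact: mulrn_wge0.
  by rewrite addr_ge0 ?normr_ge0// mulr_ge0 ?exprn_ge0.
have -> : (\det Jy *: (x - y)) 0 k = (\adj Jy *m (Jy *m v)) k 0.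
  by rewrite mulmxA mul_adj_mx mul_scalar_mx !mxE.
rewrite mxE mulrnAl; apply: le_trans (ler_norm_sum _ _ _) _.
rewrite -[X in _ *+ X]card_ord -sumr_const; apply: ler_sum => i _.
rewrite normrM ler_pM//.
have -> : \adj Jy = map_mx (meval (fun i => y 0 i)) (\adj J).
  by rewrite map_mx_adj.
by rewrite mxE; have [] := JD (k, i) y y (A01 _ Ay) (A01 _ Ay).
Qed.

Lemma polymap_null (P : polymap R n.+1) A : A `<=` unit_cube -> jac P != 0 ->
  lebesgue_rV (eval_polymap P @` A) = 0%E -> lebesgue_rV A = 0%E.
Proof.
move=> A01 P0 PA0.
pose F m := A `&` [set x | m.+1%:R^-1 <= `|eval (jac P) x|].
apply: (@sub_null _ _ _ ((unit_cube `&` [set x | eval (jac P) x = 0]) `|`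
    \bigcup_m F m)).
  move=> x Ax; have [Px|Px] := eqVneq (eval (jac P) x) 0.
    by left; split=> //; exact: A01.
  right; exists (Num.truncn `|eval (jac P) x|^-1) => //; split=> //=.
  by rewrite invf_ple ?posrE ?normr_gt0// ltW// truncnS_gt.
apply: setU_null; first exact: zeros_null.
apply: bigcup_null => m; apply: (@polymap_nonsingular_null P _ m.+1%:R^-1).
- by rewrite invr_gt0.
- by move=> x [/A01].
- by move=> x [].
- by apply: sub_null PA0; apply: image_subset => x [].
Qed.

Lemma root_map_unit_cube q x : unit_cube x -> unit_cube (root_map q x).
Proof.
move=> x01 i; have /andP[x0 x1] := x01 i; rewrite mxE powR_ge0/=.
have := @ge0_ler_powR R q%:R^-1 _ (x 0 i) 1.
by rewrite powR1; apply => //; rewrite ?nnegrE ?invr_ge0.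
Qed.

Lemma root_map_expanding q x y : (0 < q)%N -> unit_cube x -> unit_cube y ->
  `|x - y| <= q%:R * `|root_map q x - root_map q y|.
Proof.
move=> q0 x01 y01; apply: ger_norm_coord => [|i]; first exact: mulr_ge0.
have rootK (z : 'rV[R]_n.+1) : unit_cube z -> z 0 i = root_map q z 0 i ^+ q.
  move=> /(_ i)/andP[z0 z1]; rewrite mxE -powR_mulrn ?powR_ge0// -powRrM.
  by rewrite mulVf ?pnatr_eq0 -?lt0n// powRr1.
rewrite !mxE (rootK x)// (rootK y)// subrXX normrM mulrC ler_pM//.
  rewrite -[X in X%:R](card_ord q) -sumr_const.
  apply: le_trans (ler_norm_sum _ _ _) _; apply: ler_sum => k _.
  have /andP[u0 u1] := root_map_unit_cube q x01 i.
  have /andP[v0 v1] := root_map_unit_cube q y01 i.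
  by rewrite ger0_norm ?mulr_ge0 ?exprn_ge0// mulr_ile1 ?exprn_ge0 ?exprn_ile1.
by have := ler_norm_coord (root_map q x - root_map q y) i; rewrite !mxE.
Qed.

Lemma admissible_set_measure_gt0 d K :
  admissible_set d K -> (0 < lebesgue_rV K)%E.
Proof.
move=> [[w Kw] _ [Cw [aw [Ups [[_ Cw01 collection] _ KE]]]]].
have [d1 [d2 [d3 [q [P [[d10 d20 _] q0 _ KP]]]]]] := collection.
rewrite lt0e lebesgue_rV_ge0 andbT; apply/eqP => K0.
have [[_ d1C] UpsE /andP[d2J _] _] := KP w Kw.
have [_ _ C01] := Cw01 w Kw.
have J0 : jac (P w) != 0.
  apply: contraTneq d2J => ->; rewrite -ltNge /coef_norm msupp0 big_nil.
  exact: d20.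
suff C0 : lebesgue_rV (Cw w) = 0%E.
  by move: d1C; rewrite C0 lee_fin leNgt d10.
apply: (@null_expanding _ _ _ (root_map q) q%:R) => // [x y Cx Cy|].
  exact: root_map_expanding (C01 _ Cx) (C01 _ Cy).
apply: (@polymap_null (P w)) => //.
  by move=> _ [x Cx <-]; exact: root_map_unit_cube (C01 _ Cx).
apply: sub_null K0; rewrite KE => _ [_ [x Cx <-] <-]; exists w => //.
exists x => //; apply: UpsE => i.
by have /andP[] := C01 x Cx i.
Qed.

End PositiveMeasure.

(** * Reciprocals of smooth functions *)

Section ClassC.
Variables (R : realType) (n : nat).
Implicit Types (U : set 'rV[R]_n) (g h : 'rV[R]_n -> R) (x : 'rV[R]_n).
Implicit Types (s : seq 'I_n) (N : nat).

Lemma partial_eq_on U g h i : open U -> {in U, g =1 h} ->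
  {in U, partial i g =1 partial i h}.
Proof.
move=> oU gh x xU; apply: near_eq_derive.
have : nbhs x U by apply: open_nbhs_nbhs; split=> //; exact: set_mem.
by apply: filterS => y Uy; apply: gh; exact: mem_set.
Qed.

Lemma partials_eq_on U g h s : open U -> {in U, g =1 h} ->
  {in U, partials s g =1 partials s h}.
Proof.
by move=> oU gh; elim: s => //= i s IHs; exact: partial_eq_on.
Qed.

Lemma class_C_eq_on N U g h : open U -> {in U, g =1 h} ->
  class_C N U g -> class_C N U h.
Proof.
move=> oU gh [gd gc].
have sgh s x : U x -> {near x, partials s g =1 partials s h}.
  move=> Ux; have : nbhs x U by exact: open_nbhs_nbhs.
  apply: filterS => y Uy; apply: (partials_eq_on s oU gh); exact: mem_set.
split=> s x.
  by move=> i sN Ux; apply: near_eq_derivable (gd s x i sN Ux); exact: sgh.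
move=> sN Ux; rewrite /prop_for/continuous_at.
have <- : partials s g x = partials s h x by exact: nbhs_singleton (sgh s x Ux).
exact: cvg_trans (near_eq_cvg (sgh s x Ux)) (gc s x sN Ux).
Qed.

Lemma class_C0 U g : (forall x, U x -> {for x, continuous g}) -> class_C 0 U g.
Proof. by move=> gc; split=> // -[|//] x _; exact: gc. Qed.

Lemma class_CS N U g : (forall x, U x -> {for x, continuous g}) ->
  (forall x i, U x -> derivable g x (delta_mx 0 i)) ->
  (forall i, class_C N U (partial i g)) -> class_C N.+1 U g.
Proof.
move=> gc gd gN; split=> s x; case/lastP: s => [|s j].
- by move=> i _; exact: gd.
- by move=> i; rewrite size_rcons /partials foldr_rcons => sN Ux; exact: (gN j).1.
- by move=> _; exact: gc.
- by rewrite size_rcons /partials foldr_rcons => sN Ux; exact: (gN j).2.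
Qed.

Lemma class_C_continuous N U g x :
  class_C N U g -> U x -> {for x, continuous g}.
Proof. by move=> [_ gc] Ux; exact: (gc [::]). Qed.

Lemma class_C_derivable N U g x i : class_C N.+1 U g -> U x ->
  derivable g x (delta_mx 0 i).
Proof. by move=> [gd _] Ux; exact: (gd [::]). Qed.

Lemma class_C_partial N U g i : class_C N.+1 U g -> class_C N U (partial i g).
Proof.
move=> [gd gc]; split=> s x.
  move=> j sN Ux; have := gd (rcons s i) x j.
  by rewrite size_rcons /partials foldr_rcons; exact.
move=> sN Ux; have := gc (rcons s i) x.
by rewrite size_rcons /partials foldr_rcons; exact.
Qed.

Lemma class_C_le M N U g : (M <= N)%N -> class_C N U g -> class_C M U g.
Proof.
move=> MN [gd gc]; split=> s x.
  by move=> i sM; apply: gd; exact: leq_trans MN.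
by move=> sM; apply: gc; exact: leq_trans MN.
Qed.

Lemma class_C_sub N U V g : V `<=` U -> class_C N U g -> class_C N V g.
Proof.
move=> VU [gd gc]; split=> s x; first by move=> i sN /VU; exact: gd.
by move=> sN /VU; exact: gc.
Qed.

Lemma class_C_cst N U (c : R) : class_C N U (fun=> c).
Proof.
elim: N c => [|N IHN] c; first by apply: class_C0 => x _; exact: cst_continuous.
apply: class_CS => [x _|x i _|i]; [exact: cst_continuous|exact: derivable_cst|].
have -> : partial i (fun=> c) = fun=> 0 :> R; last exact: IHN.
by apply/funext => x; rewrite /partial derive_cst.
Qed.

Lemma class_CD N U g h : open U -> class_C N U g -> class_C N U h ->
  class_C N U (fun x => g x + h x).
Proof.
move=> oU; elim: N g h => [|N IHN] g h gN hN.
  apply: class_C0 => x Ux; apply: continuousD.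
    exact: class_C_continuous gN Ux.
  exact: class_C_continuous hN Ux.
apply: class_CS => [x Ux|x i Ux|i].
- apply: continuousD; first exact: class_C_continuous gN Ux.
  exact: class_C_continuous hN Ux.
- apply: derivableD; first exact: class_C_derivable gN Ux.
  exact: class_C_derivable hN Ux.
apply: (@class_C_eq_on _ _ (fun x => partial i g x + partial i h x)) => //.
  move=> x /set_mem Ux; rewrite /partial -deriveD//.
    exact: class_C_derivable gN Ux.
  exact: class_C_derivable hN Ux.
exact: IHN (class_C_partial i gN) (class_C_partial i hN).
Qed.

Lemma partialM N U g h x i : class_C N.+1 U g -> class_C N.+1 U h -> U x ->
  partial i (fun x => g x * h x) x = g x * partial i h x + h x * partial i g x.
Proof.
move=> gN hN Ux; rewrite /partial -deriveM//.
  exact: class_C_derivable gN Ux.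
exact: class_C_derivable hN Ux.
Qed.

Lemma class_CM N U g h : open U -> class_C N U g -> class_C N U h ->
  class_C N U (fun x => g x * h x).
Proof.
move=> oU; elim: N g h => [|N IHN] g h gN hN.
  apply: class_C0 => x Ux; apply: continuousM.
    exact: class_C_continuous gN Ux.
  exact: class_C_continuous hN Ux.
apply: class_CS => [x Ux|x i Ux|i].
- apply: continuousM; first exact: class_C_continuous gN Ux.
  exact: class_C_continuous hN Ux.
- apply: derivableM; first exact: class_C_derivable gN Ux.
  exact: class_C_derivable hN Ux.
apply: (@class_C_eq_on _ _
    (fun x => g x * partial i h x + h x * partial i g x)) => //.
  by move=> x /set_mem Ux; rewrite (partialM _ gN hN).
apply: (class_CD oU).
  exact: IHN (class_C_le (leqnSn N) gN) (class_C_partial i hN).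
exact: IHN (class_C_le (leqnSn N) hN) (class_C_partial i gN).
Qed.

Lemma class_CV N U g : open U -> (forall x, U x -> g x != 0) ->
  class_C N U g -> class_C N U (fun x => (g x)^-1).
Proof.
move=> oU g0; elim: N => [|N IHN] gN.
  apply: class_C0 => x Ux; apply: continuousV (g0 _ Ux) _.
  exact: class_C_continuous gN Ux.
apply: class_CS => [x Ux|x i Ux|i].
- by apply: continuousV (g0 _ Ux) _; exact: class_C_continuous gN Ux.
- by apply: derivableV (g0 _ Ux) _; exact: class_C_derivable gN Ux.
have gVN : class_C N U (fun x => (g x)^-1).
  exact: IHN (class_C_le (leqnSn N) gN).
apply: (@class_C_eq_on _ _
    (fun x => -1 * (((g x)^-1 * (g x)^-1) * partial i g x))) => //.
  move=> x /set_mem Ux; rewrite /partial deriveV//.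
    by rewrite mulN1r -expr2 exprVn scaleNr.
  - exact: g0.
  - exact: class_C_derivable gN Ux.
apply: (class_CM oU (class_C_cst N U (-1))).
exact: class_CM oU (class_CM oU gVN gVN) (class_C_partial i gN).
Qed.

End ClassC.

Section Leibniz.
Variables (R : realType) (n : nat).
Implicit Types (U : set 'rV[R]_n) (g h : 'rV[R]_n -> R) (x : 'rV[R]_n).
Implicit Types (m : multinom n).

Lemma partials_cst (s : seq 'I_n) (c : R) x :
  s != [::] -> partials s (fun=> c) x = 0.
Proof.
case/lastP: s => // s i _; rewrite /partials foldr_rcons.
have -> : partial i (fun=> c) = fun=> 0 :> R.
  by apply/funext => y; rewrite /partial derive_cst.
elim: s x => //= j s IHs x; rewrite /partial (_ : foldr _ _ _ = fun=> 0).
  by rewrite derive_cst.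
exact/funext.
Qed.

Lemma derive_bigsum (I : Type) (r : seq I) (P : pred I)
    (F : I -> 'rV[R]_n -> R) x (v : 'rV[R]_n) :
  (forall i, P i -> derivable (F i) x v) ->
  'D_v (fun y => \sum_(i <- r | P i) F i y) x =
    \sum_(i <- r | P i) 'D_v (F i) x.
Proof.
move=> dF; suff /(_ r)[] : forall r : seq I,
    derivable (fun y => \sum_(i <- r | P i) F i y) x v /\
    'D_v (fun y => \sum_(i <- r | P i) F i y) x =
      \sum_(i <- r | P i) 'D_v (F i) x by [].
elim=> [|i {}r [dr Dr]].
  under eq_fun do rewrite big_nil.
  by rewrite big_nil derive_cst; split=> //; exact: derivable_cst.
under eq_fun do rewrite big_cons; rewrite big_cons.
case: ifPn => // Pi; split; first by apply: derivableD => //; exact: dF.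
by rewrite -Dr -deriveD//; exact: dF.
Qed.

Definition mnm_seq m : seq 'I_n := flatten [seq nseq (m i) i | i <- enum 'I_n].

Lemma size_mnm_seq m : size (mnm_seq m) = mdeg m.
Proof.
rewrite /mnm_seq size_flatten /shape -map_comp sumnE big_map mdegE.
by rewrite big_enum; apply: eq_bigr => i _ /=; rewrite size_nseq.
Qed.

Definition supported_from (i : 'I_n) m : Prop :=
  forall j : 'I_n, (j < i)%N -> m j = 0%N.

Lemma mnm_seq_addU m i : supported_from i m ->
  mnm_seq (mnm_add m (mnm1 i)) = i :: mnm_seq m.
Proof.
move=> mi; rewrite /mnm_seq.
have : sorted (fun j k : 'I_n => (j < k)%N) (enum 'I_n).
  by have := iota_ltn_sorted 0 n; rewrite -val_enum_ord sorted_map.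
have : i \in enum 'I_n by rewrite mem_enum.
elim: (enum 'I_n) => //= j r IHr; rewrite inE => /orP[/eqP <-|ir] jr.
  rewrite mnmDE mnm1E eqxx addn1 /=; congr (_ :: _ ++ flatten _).
  apply/eq_in_map => k kr; rewrite mnmDE mnm1E.
  have /allP/(_ k kr) := order_path_min (fun _ _ _ => @ltn_trans _ _ _) jr.
  by case: eqVneq => [->|_ _]; rewrite ?ltnn ?addn0.
have /allP/(_ i ir) ji := order_path_min (fun _ _ _ => @ltn_trans _ _ _) jr.
rewrite mnmDE mnm1E (mi j ji); have -> : (i == j) = false.
  by apply/eqP => ij; rewrite ij ltnn in ji.
by rewrite /= IHr//; exact: path_sorted jr.
Qed.

Lemma first_variable m : m != mnm0 -> exists i m',
  m = mnm_add m' (mnm1 i) /\ supported_from i m'.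
Proof.
move=> m0; have [i mi] : exists i, m i != 0%N.
  apply: contrapT => /forallNP mE; move/eqP: m0; apply; apply/mnmP => i.
  by rewrite mnm0E; apply/eqP/negPn/negP; exact: mE.
case: (@arg_minnP _ i (fun j => m j != 0%N) (@nat_of_ord n) mi) => j mj j_min.
exists j, (mnm_sub m (mnm1 j)); rewrite submK ?lep1mP//; split=> // k kj.
rewrite mnmBE; suff -> : m k = 0%N by [].
by apply/eqP/negPn/negP => /j_min; rewrite leqNgt kj.
Qed.

Definition nderiv m g x : R :=
  (\prod_k (m k)`!)%:R^-1 * multi_partial m g x.

Lemma multi_partialE m g : multi_partial m g = partials (mnm_seq m) g.
Proof. by []. Qed.

Lemma nderiv_derivable N U m g x (i : 'I_n) : class_C N U g -> U x ->
  (mdeg m < N)%N -> derivable (nderiv m g) x (delta_mx 0 i).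
Proof.
move=> [gd _] Ux mN; apply: derivableM; first exact: derivable_cst.
by rewrite multi_partialE; apply: gd => //; rewrite size_mnm_seq.
Qed.

Lemma partial_nderiv N U m g x i : class_C N U g -> U x ->
  (mdeg m < N)%N -> supported_from i m ->
  partial i (nderiv m g) x = nderiv (mnm_add m (mnm1 i)) g x *+ (m i).+1.
Proof.
move=> [gd _] Ux mN mi.
have gm : derivable (multi_partial m g) x (delta_mx 0 i).
  by rewrite multi_partialE; apply: gd => //; rewrite size_mnm_seq.
have -> : partial i (nderiv m g) x =
    (\prod_k (m k)`!)%:R^-1 * partial i (multi_partial m g) x.
  exact: deriveMl.
rewrite /nderiv [in RHS]multi_partialE mnm_seq_addU//= -mulrnAl; congr (_ * _).
rewrite [in RHS](bigD1 i)//= [in LHS](bigD1 i)//= mnmDE mnm1E eqxx addn1 factS.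
rewrite [in RHS](eq_bigr (fun k => (m k)`!)) => [|k /negbTE ki]; last first.
  by rewrite mnmDE mnm1E eq_sym ki addn0.
rewrite -mulnA -[RHS]mulr_natr; set F := ((m i)`! * _)%N.
by rewrite natrM invfM mulrAC mulVf ?mul1r// pnatr_eq0.
Qed.

Definition taylor_poly N g x : mpoly n R :=
  \sum_(m : bmultinom n N.+1) nderiv m g x *: mpolyX R m.

Lemma mcoeff_taylor_poly N g x m : (mdeg m <= N)%N ->
  mcoeff m (taylor_poly N g x) = nderiv m g x.
Proof.
rewrite -ltnS => mN; exact: (mcoeff_mpoly (fun m => nderiv m g x) mN).
Qed.

Lemma nderiv_mnm0 g x : nderiv mnm0 g x = g x.
Proof.
rewrite /nderiv multi_partialE (_ : mnm_seq _ = [::])/=; last first.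
  by apply/eqP; rewrite -size_eq0 size_mnm_seq mdeg0.
by rewrite big1 ?invr1 ?mul1r// => k _; rewrite mnm0E.
Qed.

Lemma mcoeff_mulE (p q : mpoly n R) N m : (mdeg m <= N)%N ->
  mcoeff m (p * q) = \sum_(k : bmultinom n N.+1 * bmultinom n N.+1 |
    m == mnm_add k.1 k.2) mcoeff k.1 p * mcoeff k.2 q.
Proof. by rewrite -ltnS => mN; exact: mcoeff_poly_mul. Qed.

(* Differentiating the coefficient identity in the variable [i] corresponds to
   the product rule for the formal derivative of the two Taylor polynomials. *)
Lemma nderivM N U g h x m : open U -> class_C N U g -> class_C N U h ->
  U x -> (mdeg m <= N)%N ->
  nderiv m (fun y => g y * h y) x =
    mcoeff m (taylor_poly N g x * taylor_poly N h x).
Proof.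
move=> oU gN hN; have [d] := ubnP (mdeg m).
elim: d m x => // d IHd m x md Ux mN.
have [->|/first_variable[i [m' [mE m'i]]]] := eqVneq m mnm0.
  rewrite nderiv_mnm0 (mcoeff_mulE _ _ (N := N)) ?mdeg0//.
  rewrite (bigD1 (bm0, bm0))/= ?addm0 ?eqxx// big1 => [|[k1 k2]/=].
    by rewrite addr0 !mcoeff_taylor_poly ?mdeg0// !nderiv_mnm0.
  move=> /andP[/eqP/esym/eqP]; rewrite -mdeg_eq0 mdegD addn_eq0 !mdeg_eq0.
  move=> /andP[/eqP k10 /eqP k20] /negP[].
  by apply/eqP; congr (_, _); apply: val_inj.
have m'N : (mdeg m' < N)%N by rewrite mE mdegD mdeg1 addn1 in mN.
have m'd : (mdeg m' < d)%N by rewrite mE mdegD mdeg1 addn1 ltnS in md.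
have ghN : class_C N U (fun y => g y * h y) by exact: class_CM.
apply: (@mulIf _ (m' i).+1%:R); first by rewrite pnatr_eq0.
rewrite !mulr_natr [in LHS]mE -(partial_nderiv ghN Ux m'N m'i).
rewrite [in RHS]mE -mcoeff_mderiv mderivM mcoeffD.
rewrite !(mcoeff_mulE _ _ (ltnW m'N)) -big_split/=.
pose S y := \sum_(k : bmultinom n N.+1 * bmultinom n N.+1 |
  m' == mnm_add k.1 k.2) nderiv k.1 g y * nderiv k.2 h y.
have -> : partial i (nderiv m' (fun y => g y * h y)) x = partial i S x.
  apply: (@partial_eq_on _ _ U) => //; last exact: mem_set.
  move=> y /set_mem Uy; rewrite (IHd _ _ m'd Uy (ltnW m'N)).
  rewrite (mcoeff_mulE _ _ (ltnW m'N)); apply: eq_bigr => k _.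
  by rewrite !mcoeff_taylor_poly ?bmdeg// -ltnS bmdeg.
have split_m' (k : bmultinom n N.+1 * bmultinom n N.+1) :
    m' == mnm_add k.1 k.2 ->
  [/\ (mdeg k.1 < N)%N, (mdeg k.2 < N)%N, supported_from i k.1 &
      supported_from i k.2].
  move=> /eqP m'E; move: m'N m'i; rewrite m'E mdegD => kN ki.
  split; [exact: leq_ltn_trans (leq_addr _ _) kN|
    exact: leq_ltn_trans (leq_addl _ _) kN| |].
  - by move=> j /ki /eqP; rewrite mnmDE addn_eq0 => /andP[/eqP].
  - by move=> j /ki /eqP; rewrite mnmDE addn_eq0 => /andP[_ /eqP].
rewrite /partial derive_bigsum => [|k /split_m'[k1 k2 _ _]]; last first.
  apply: derivableM; first exact: nderiv_derivable gN Ux k1.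
  exact: nderiv_derivable hN Ux k2.
apply: eq_bigr => k /split_m'[k1 k2 k1i k2i].
rewrite deriveM; last 2 first.
- exact: nderiv_derivable gN Ux k1.
- exact: nderiv_derivable hN Ux k2.
rewrite -/(partial i _ x) -/(partial i (nderiv k.1 g) x).
rewrite (partial_nderiv gN Ux k1 k1i) (partial_nderiv hN Ux k2 k2i).
rewrite !mcoeff_mderiv !mcoeff_taylor_poly ?mdegD ?mdeg1 ?addn1//.
- by rewrite addrC; congr (_ + _); rewrite mulrC.
- exact: ltnW.
- exact: ltnW.
Qed.

Definition jet_sum N g x (j : nat) : R :=
  \sum_(m : bmultinom n N.+1 | mdeg m == j) `|nderiv m g x|.

Lemma jet_sum_ge0 N g x j : 0 <= jet_sum N g x j.
Proof. exact: sumr_ge0. Qed.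

Lemma jet_sum0 N g x : jet_sum N g x 0 = `|g x|.
Proof.
rewrite /jet_sum (bigD1 bm0)/= ?mdeg0// nderiv_mnm0 big1 ?addr0// => m.
rewrite mdeg_eq0 => /andP[/eqP m0 /negP[]].
by apply/eqP; apply: val_inj.
Qed.

Lemma jet_sum_reciprocal N U g h (c : R) x j : open U ->
  class_C N U g -> class_C N U h -> {in U, forall y, g y * h y = c} -> U x ->
  (0 < j <= N)%N ->
  `|g x| * jet_sum N h x j <=
    \sum_(1 <= k < j.+1) jet_sum N g x k * jet_sum N h x (j - k).
Proof.
move=> oU gN hN ghc Ux /andP[j0 jN].
pose B : finType := bmultinom n N.+1.
pose a (k : B) := `|nderiv k g x|; pose b (k : B) := `|nderiv k h x|.
have isolate (m : B) : mdeg m = j -> `|g x| * b m <=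
    \sum_(k : B * B | (m == mnm_add k.1 k.2 :> multinom n) && (k.1 != bm0))
      a k.1 * b k.2.
  move=> mj; have mN : (mdeg m <= N)%N by rewrite mj.
  have : nderiv m (fun y => g y * h y) x = 0.
    rewrite /nderiv multi_partialE (@partials_eq_on _ _ U _ (fun=> c))//.
      rewrite partials_cst ?mulr0//.
      by rewrite -size_eq0 size_mnm_seq mj -lt0n.
    exact: mem_set.
  rewrite (nderivM oU gN hN Ux mN) (mcoeff_mulE _ _ mN).
  rewrite (bigD1 (bm0, m))/= ?add0m ?eqxx//.
  rewrite !mcoeff_taylor_poly ?mdeg0// nderiv_mnm0 => /eqP.
  rewrite addr_eq0 => /eqP gh; rewrite /b -normrM gh normrN.
  apply: le_trans (ler_norm_sum _ _ _) _.
  rewrite [leLHS]big_mkcond [leRHS]big_mkcond; apply: ler_sum => -[k1 k2] _ /=.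
  have [mk|//] := eqVneq; rewrite /=.
  have -> : ((k1, k2) != (bm0, m)) = (k1 != bm0).
    have [k10|k10] := eqVneq k1 bm0; last first.
      by apply: contra k10 => /eqP[->].
    apply/negbTE/negPn/eqP; congr (_, _) => //.
    by apply: val_inj => /=; rewrite mk k10 /= add0m.
  case: ifP => // _.
  by rewrite normrM !mcoeff_taylor_poly// -ltnS bmdeg.
rewrite /jet_sum mulr_sumr.
apply: (@le_trans _ _ (\sum_(m : B | mdeg m == j)
    \sum_(k : B * B | (m == mnm_add k.1 k.2 :> multinom n) && (k.1 != bm0))
      a k.1 * b k.2)).
  by apply: ler_sum => m /eqP; exact: isolate.
rewrite (exchange_big_dep (fun k : B * B => (0 < mdeg k.1)%N &&
    (mdeg k.1 + mdeg k.2 == j)%N))/=; last first.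
  move=> m k /eqP mj /andP[/eqP mk k10]; rewrite -mdegD -mk mj eqxx andbT.
  by rewrite lt0n mdeg_eq0; apply: contra k10 => /eqP k10; apply/eqP/val_inj.
apply: (@le_trans _ _ (\sum_(k : B * B | (0 < mdeg k.1)%N &&
    (mdeg k.1 + mdeg k.2 == j)%N) a k.1 * b k.2)).
  apply: ler_sum => k /andP[k10 /eqP kj].
  have kN : (mdeg (mnm_add k.1 k.2) < N.+1)%N by rewrite mdegD kj ltnS.
  rewrite (big_pred1 (BMultinom kN)) => // m /=.
  have -> : k.1 != bm0.
    by apply: contraTneq k10 => ->; rewrite mdeg0.
  rewrite andbT; apply/andP/eqP => [[_ /eqP mk]|->]; first exact: val_inj.
  by rewrite /= mdegD kj.
under [leRHS]eq_bigr do rewrite big_distrlr pair_big/=.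
rewrite [leRHS]big_nat_cond (exchange_big_dep (fun k : B * B =>
  (0 < mdeg k.1)%N && (mdeg k.1 + mdeg k.2 == j)%N))/=; last first.
  move=> i k; rewrite andbT => /andP[i0 ij] /andP[/eqP -> /eqP ->].
  by rewrite i0 subnKC ?eqxx// -ltnS.
apply: ler_sum => k /andP[k10 /eqP kj].
rewrite big_mkcond (bigD1_seq (mdeg k.1)) ?iota_uniq//=; last first.
  by rewrite mem_index_iota k10 ltnS -kj leq_addr.
rewrite k10 ltnS -kj leq_addr eqxx addKn eqxx /= lerDl; apply: sumr_ge0 => i _.
by case: ifP => // _; rewrite mulr_ge0.
Qed.

End Leibniz.

Section Reciprocal.
Variable R : realType.

Lemma reciprocal_growth (u v : nat -> R) (J : nat) (M m0 rho : R) :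
  0 < m0 -> 0 < M -> 0 <= rho -> (forall k, 0 <= v k) -> v 0%N <= M ->
  (forall k, (0 < k <= J)%N -> u k <= M * rho ^+ k) ->
  (forall j, (0 < j <= J)%N ->
     m0 * v j <= \sum_(1 <= k < j.+1) u k * v (j - k)%N) ->
  forall j, (j <= J)%N -> v j <= M * ((1 + M / m0) * rho) ^+ j.
Proof.
move=> m0_gt0 M_gt0 rho0 v0 v0M uM vrec j; pose b := 1 + M / m0.
have b0 : 0 <= b by rewrite addr_ge0// divr_ge0// ltW.
elim/ltn_ind: j => -[|j] IHj jJ; first by rewrite expr0 mulr1.
rewrite -(ler_pM2l m0_gt0); apply: le_trans (vrec _ _) _ => //.
apply: (@le_trans _ _ (\sum_(1 <= k < j.+2)
    M * rho ^+ k * (M * (b * rho) ^+ (j.+1 - k)))).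
  apply: ler_sum_nat => k /andP[k0 kj].
  have kJ : (k <= J)%N by rewrite (leq_trans _ jJ).
  apply: (@le_trans _ _ (M * rho ^+ k * v (j.+1 - k)%N)).
    by rewrite ler_wpM2r// uM// k0.
  apply: ler_wpM2l; first by rewrite mulr_ge0 ?exprn_ge0// ltW.
  apply: IHj; first by rewrite ltn_subrL k0.
  by rewrite (leq_trans (leq_subr _ _)).
have -> : \sum_(1 <= k < j.+2) M * rho ^+ k * (M * (b * rho) ^+ (j.+1 - k)) =
    m0 * (M * rho ^+ j.+1) * ((b - 1) * \sum_(i < j.+1) b ^+ i).
  rewrite (_ : b - 1 = M / m0); last by rewrite /b addrC addKr.
  rewrite big_add1 /= big_mkord [in RHS](reindex_inj rev_ord_inj)/= !mulr_sumr.
  apply: eq_bigr => i _; rewrite !subSS exprMn.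
  have -> : rho ^+ j.+1 = rho ^+ i.+1 * rho ^+ (j - i).
    by rewrite -exprD addSn subnKC// -ltnS.
  by field; rewrite gt_eqF.
have -> : m0 * (M * ((1 + M / m0) * rho) ^+ j.+1) =
    m0 * (M * rho ^+ j.+1) * b ^+ j.+1 by rewrite -/b exprMn; ring.
rewrite -subrX1 ler_wpM2l ?gerBl//.
by rewrite !mulr_ge0 ?exprn_ge0// ltW.
Qed.

End Reciprocal.

Section JetNorm.
Variables (R : realType) (n : nat).
Implicit Types (g h : 'rV[R]_n -> R) (x : 'rV[R]_n).

Lemma jet_norm_const_mx N g x j : (j <= N)%N ->
  jet_norm (fun y => const_mx (g y) : 'rV[R]_1) j x =
    (j`!)%:R * jet_sum N g x j.
Proof.
move=> jN; rewrite /jet_norm big_ord1.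
have -> : component (fun y => const_mx (g y) : 'rV[R]_1) ord0 = g.
  by apply/funext => y; rewrite /component mxE.
rewrite /jet_sum mulr_sumr.
pose to_ffun (m : bmultinom n N.+1) : {ffun 'I_n -> 'I_j.+1} :=
  [ffun k => inord (m k)].
pose to_mnm (a : {ffun 'I_n -> 'I_j.+1}) : multinom n :=
  Multinom [tuple (a i : nat) | i < n].
have to_mnmE a k : to_mnm a k = a k by exact: mnmE.
have mdeg_to_mnm a : mdeg (to_mnm a) = (\sum_k a k)%N.
  by rewrite mdegE; apply: eq_bigr => k _; rewrite to_mnmE.
pose of_ffun a : bmultinom n N.+1 := insubd bm0 (to_mnm a).
have of_ffunE (a : {ffun 'I_n -> 'I_j.+1}) :
    (\sum_k a k)%N == j -> of_ffun a = to_mnm a :> multinom n.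
  by move=> /eqP aj; rewrite insubdK// unfold_in mdeg_to_mnm aj ltnS.
rewrite (reindex_onto to_ffun of_ffun) => [|a aj]; last first.
  by apply/ffunP => k; rewrite ffunE of_ffunE// to_mnmE inord_val.
have to_ffunE (m : bmultinom n N.+1) k : mdeg m = j -> to_ffun m k = m k :> nat.
  move=> mj; rewrite ffunE inordK// ltnS -mj mdegE (bigD1 k)//=.
  exact: leq_addr.
apply: eq_big => [m|m /andP[aj /eqP mE]].
  apply/andP/eqP => [[aj /eqP mE]|mj].
    by rewrite -mE of_ffunE// mdeg_to_mnm; exact/eqP.
  have aj : (\sum_k to_ffun m k)%N == j.
    apply/eqP; apply: (etrans _ mj); rewrite mdegE.
    by apply: eq_bigr => k _; exact: (to_ffunE _ _ mj).
  split=> //; apply/eqP/val_inj; rewrite /= of_ffunE//; apply/mnmP => k.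
  by rewrite to_mnmE to_ffunE.
have mk k : to_ffun m k = m k :> nat.
  by apply: to_ffunE; rewrite -mE of_ffunE// mdeg_to_mnm; exact/eqP.
rewrite /nderiv normrM normfV normr_nat mulrA.
have -> : (fun k : 'I_n => to_ffun m k : nat) = m.
  by apply/funext => k; exact: mk.
by under eq_bigr do rewrite mk.
Qed.

Lemma weight_prod_gt0 (mu : nat -> R) j :
  admissible_weight mu -> 0 < \prod_(1 <= i < j.+1) mu i.
Proof.
move=> [mu1 mu_incr]; rewrite big_add1 big_mkord; apply: prodr_gt0 => i _.
elim: (i : nat) => //= k IHk; exact: lt_le_trans IHk (mu_incr _ _).
Qed.

Lemma smooth_reciprocal (L : set 'rV[R]_n) (mu : nat -> R) (N : nat)
    (H M0 m0 beta : R) (f : 'rV[R]_n -> R) :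
  admissible_weight mu -> 1 <= H ->
  (let a := fun j : nat =>
      ((\prod_(1 <= i < j.+1) mu i) / (j`!)%:R) `^ (j%:R^-1) in
    forall j k, (1 <= j)%N -> (j <= k)%N -> a j <= H * a k) ->
  0 < m0 -> m0 <= M0 -> (1 + M0 / m0) * H <= beta ->
  smooth mu N M0 L (fun x => const_mx (f x) : 'rV[R]_1) ->
  (forall x, L x -> m0 <= `|f x|) ->
  smooth (fun j => beta * mu j) N M0 L
    (fun x => const_mx (M0 * m0 / f x) : 'rV[R]_1).
Proof.
move=> mu_adm H1; cbv zeta; set a := (fun j : nat => _ `^ _) => aH m0_gt0 M0_ge.
move=> betaE [[U [oU LU fC]] fM] f_ge.
have M0_gt0 : 0 < M0 := lt_le_trans m0_gt0 M0_ge.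
have fN : class_C N U f.
  by have := fC ord0; congr class_C; apply/funext => y; rewrite /component mxE.
pose V := U `&` [set x | f x != 0].
have oV : open V.
  rewrite openE => x [Ux fx0]; apply: filterI; first exact: open_nbhs_nbhs.
  exact: cvgr_neq0 (class_C_continuous fN Ux) fx0.
have LV : L `<=` V.
  move=> x Lx; split; first exact: LU.
  by rewrite /= -normr_gt0 (lt_le_trans m0_gt0)// f_ge.
have fV : class_C N V f by apply: class_C_sub fN => x [].
pose g x := M0 * m0 / f x.
have gV : class_C N V g.
  apply: class_CM => //; first exact: class_C_cst.
  by apply: class_CV => // x [].
split.
  exists V; split=> // i; have := gV; congr class_C.
  by apply/funext => y; rewrite /component mxE.
move=> J x JN Lx; rewrite (jet_norm_const_mx _ _ JN).
have P0 j : 0 < \prod_(1 <= i < j.+1) mu i by exact: weight_prod_gt0.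
have aX j : (0 < j)%N -> a j ^+ j = (\prod_(1 <= i < j.+1) mu i) / (j`!)%:R.
  move=> j0; rewrite /a -powR_mulrn ?powR_ge0// -powRrM.
  by rewrite mulVf ?pnatr_eq0 -?lt0n// powRr1// divr_ge0// ltW.
have f_jet k : (k <= N)%N ->
    jet_sum N f x k <= M0 * ((\prod_(1 <= i < k.+1) mu i) / (k`!)%:R).
  move=> kN; rewrite mulrA ler_pdivlMr ?ltr0n ?fact_gt0// mulrC.
  by have := fM k x kN Lx; rewrite (jet_norm_const_mx _ _ kN).
have g0 : jet_sum N g x 0 <= M0.
  have fx0 := lt_le_trans m0_gt0 (f_ge _ Lx).
  rewrite jet_sum0 /g normrM normfV (ger0_norm (ltW (mulr_gt0 M0_gt0 m0_gt0))).
  by rewrite ler_pdivrMr// ler_pM2l// f_ge.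
have [->|J0] := posnP J.
  by rewrite fact0 mul1r /weight_bound big_geq// mulr1.
pose rho := H * a J.
have rho0 : 0 <= rho by rewrite mulr_ge0 ?powR_ge0// (le_trans _ H1).
have fJ k : (0 < k <= J)%N -> jet_sum N f x k <= M0 * rho ^+ k.
  move=> /andP[k0 kJ]; apply: le_trans (f_jet _ (leq_trans kJ JN)) _.
  rewrite ler_pM2l// -aX// lerXn2r ?nnegrE ?powR_ge0//.
  exact: aH.
have gJ j : (0 < j <= J)%N -> m0 * jet_sum N g x j <=
    \sum_(1 <= k < j.+1) jet_sum N f x k * jet_sum N g x (j - k).
  move=> /andP[j0 jJ].
  apply: (@le_trans _ _ (`|f x| * jet_sum N g x j)).
    by rewrite ler_wpM2r ?jet_sum_ge0 ?f_ge.
  apply: (jet_sum_reciprocal (c := M0 * m0) oV fV gV _ (LV _ Lx)).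
    by move=> y /set_mem[_ fy0]; rewrite /g mulrC divfK.
  by rewrite j0 (leq_trans jJ).
have gle := reciprocal_growth m0_gt0 M0_gt0 rho0 (jet_sum_ge0 N g x) g0 fJ gJ
  (leqnn J).
have -> : weight_bound (fun j => beta * mu j) M0 J =
    (J`!)%:R * (M0 * (beta ^+ J * a J ^+ J)).
  rewrite /weight_bound aX// big_split/= prodr_const_nat subn1/=.
  by field; rewrite pnatr_eq0 -lt0n fact_gt0.
rewrite ler_wpM2l// (le_trans gle)// ler_pM2l// -exprMn mulrA.
have bH : 0 <= (1 + M0 / m0) * H.
  by rewrite mulr_ge0 ?(le_trans _ H1)// addr_ge0// divr_ge0// ltW.
have aJ0 : 0 <= a J by exact: powR_ge0.
have bHa := ler_wpM2r aJ0 betaE.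
have bHa0 := mulr_ge0 bH aJ0.
by rewrite lerXn2r ?nnegrE// (le_trans bHa0).
Qed.

End JetNorm.

(** * Rescaling of the weight *)

Section Rescaling.
Variables (R : realType) (beta : R).
Hypothesis beta_gt0 : 0 < beta.
Implicit Types (mu : nat -> R) (h : R -> R).

(* No convergence is needed: [lim] has the value 0 where there is no limit. *)
Lemma limZ_total (T : Type) (F : set_system T) (f : T -> R) : ProperFilter F ->
  lim ((fun t => beta * f t) @ F) = beta * lim (f @ F).
Proof.
move=> FF; have [fF|fF] := pselect (cvg (f @ F)).
  by apply: cvg_lim => //; exact: cvgM (cvg_cst beta) fF.
have bfF : ~ cvg ((fun t => beta * f t) @ F).
  apply: contra_not fF => bfF.
  by rewrite -(is_cvgMlE_tmp _ (lt0r_neq0 beta_gt0)).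
by rewrite (dvgP fF) (dvgP bfF) [RHS]mulr0.
Qed.

Lemma one_sided_derivativeZ h s :
  one_sided_derivative (fun t => beta * h t) s =
    beta * one_sided_derivative h s.
Proof.
rewrite /one_sided_derivative.
have -> : (fun u : R => (beta * h (s + u) - beta * h s) / u) =
    fun u => beta * ((h (s + u) - h s) / u).
  by apply/funext => u; rewrite -mulrBr mulrA.
by case: ifP => _; apply: limZ_total.
Qed.

Lemma CNZ h N : CN (fun t => beta * h t) N = CN h N.
Proof.
congr ((4 * expR (4 + sup _)) ^+ _); apply: eq_imagel => s _.
by rewrite one_sided_derivativeZ mulrCA -mulf_div divff ?mul1r// gt_eqF.
Qed.

Lemma admissible_weightZ mu :
  admissible_weight mu -> admissible_weight (fun j => beta * mu j).
Proof.
move=> [mu1 mu_incr]; split=> [|j j1]; first exact: mulr_gt0.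
by rewrite ler_pM2l// mu_incr.
Qed.

Lemma weight_extensionZ mu h : weight_extension mu h ->
  weight_extension (fun j => beta * mu j) (fun t => beta * h t).
Proof.
move=> [h_gt0 h_incr h_cont [t [t0 t_incr t_oo tC1]] h_mu]; split.
- by move=> s s1; rewrite mulr_gt0// h_gt0.
- by move=> s u s1 u1 su; rewrite ler_pM2l// h_incr.
- by move=> s; apply: cvgM (cvg_cst beta) _; exact: h_cont.
- exists t; split=> // i; have [g [gd gc hg]] := tC1 i.
  exists (fun s => beta * g s); split=> [s||s si].
  + exact: derivableM.
  + have -> : derive1 (fun s => beta * g s) = fun s => beta * derive1 g s.
      by apply/funext => s; rewrite !derive1E deriveMl.
    by move=> s; apply: cvgM (cvg_cst beta) _; exact: gc.
  + by rewrite hg.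
- by move=> j j1; rewrite h_mu.
Qed.

Lemma degreeZ mu A a b :
  degree (fun j => beta * mu j) A a b = degree mu A (a * beta) b.
Proof.
rewrite /degree; congr (2 * supremum 0 _)%N; apply: eq_set => k.
by under eq_bigr do rewrite mulrA.
Qed.

Lemma admissible_tupleZ mu A a b : admissible_weight mu ->
  admissible_tuple mu A (a * beta) b ->
  admissible_tuple (fun j => beta * mu j) A a b.
Proof.
move=> mu_adm; rewrite /admissible_tuple => mu_gt.
have muV k : (start_index A b < k)%N -> (0 <= ((mu k)^-1)%:E)%E.
  case: k => // k _; rewrite lee_fin invr_ge0.
  have [mu1 mu_incr] := mu_adm.
  by elim: k => [|k IHk]; [exact: ltW|exact: le_trans IHk (mu_incr _ _)].
have -> : (\sum_((start_index A b).+1 <= j <oo) ((beta * mu j)^-1)%:E =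
    (beta^-1)%:E * \sum_((start_index A b).+1 <= j <oo) ((mu j)^-1)%:E)%E.
  rewrite [X in (_ * X)%E]eseries_cond -nneseriesZl; last first.
    by move=> k; exact: muV.
  by rewrite [LHS]eseries_cond; apply: eq_eseriesr => k _; rewrite invfM EFinM.
by rewrite muleC lte_pdivlMr// -EFinM mulrAC.
Qed.

End Rescaling.

(** * Remez inequality on half of the set *)

Section LevelSets.
Variables (R : realType) (n : nat).
Implicit Types (K E L U : set 'rV[R]_n.+1) (f : 'rV[R]_n.+1 -> R).

Definition volume E : R := fine (lebesgue_rV E).

Lemma lebesgue_rV_fin_num K E : compact K -> E `<=` K ->
  lebesgue_rV E \is a fin_num.
Proof.
move=> cK EK; rewrite ge0_fin_numE ?lebesgue_rV_ge0//.
exact: le_lt_trans (le_lebesgue_rV EK) (lebesgue_rV_compact_lty cK).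
Qed.

Lemma volume_ge0 E : 0 <= volume E.
Proof. by rewrite fine_ge0// lebesgue_rV_ge0. Qed.

Lemma le_volume K E F : compact K -> F `<=` K -> E `<=` F ->
  volume E <= volume F.
Proof.
move=> cK FK EF; apply: fine_le; last exact: le_lebesgue_rV.
- by apply: lebesgue_rV_fin_num cK _; exact: subset_trans FK.
- exact: lebesgue_rV_fin_num cK FK.
Qed.

Lemma volume_le_setU K E F : compact K -> E `<=` K -> F `<=` K ->
  volume (E `|` F) <= volume E + volume F.
Proof.
move=> cK EK FK; have EFK : E `|` F `<=` K by move=> x [/EK|/FK].
rewrite -lee_fin EFinD /volume !fineK ?(lebesgue_rV_fin_num cK)//.
exact: outer_measureU2.
Qed.

(* [l] is a median of [f], up to the perturbation [e], which spares us the
   continuity of the measure along monotone sequences. *)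
Lemma approximate_median K f (m M : R) : compact K -> 0 < volume K ->
  (forall x, K x -> m <= f x <= M) ->
  exists2 l : R, m <= l & forall e : R, 0 < e ->
    volume K <= 2 * volume (K `&` [set x | f x <= l + e]) /\
    volume K <= 2 * volume (K `&` [set x | l - e <= f x]).
Proof.
move=> cK K0 fmM.
pose S := [set l : R | volume K <= 2 * volume (K `&` [set x | f x <= l])].
have SM : S M.
  rewrite /S /= (_ : K `&` _ = K) ?ler_peMl ?ler1n ?volume_ge0//.
  by apply/seteqP; split=> [x []//|x Kx]; split=> //=; have /andP[] := fmM x Kx.
have Sm : lbound S m.
  move=> l Sl; rewrite leNgt; apply/negP => lm; move: Sl; rewrite /S /=.
  rewrite (_ : K `&` _ = set0); last first.
    rewrite -subset0 => x [Kx /= fxl]; have /andP[] := fmM x Kx.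
    by rewrite leNgt (le_lt_trans fxl).
  by rewrite /volume lebesgue_rV_set0/= mulr0 leNgt K0.
have Sinf : has_inf S by split; [exists M|exists m].
exists (inf S); first by apply: lb_le_inf => //; exists M.
move=> e e0; split.
  have [l Sl le] := inf_adherent e0 Sinf.
  apply: (le_trans Sl); rewrite ler_pM2l//; apply: (le_volume cK) => [x []//|].
  by move=> x [Kx /= fxl]; split=> //=; rewrite (le_trans fxl)// ltW.
have : ~ S (inf S - e).
  by move=> /(ge_inf Sinf.2); rewrite leNgt gtrBl e0.
move=> /negP; rewrite /S /= -ltNge => Se.
have : volume K <= volume (K `&` [set x | f x <= inf S - e]) +
    volume (K `&` [set x | inf S - e <= f x]).
  apply: le_trans (volume_le_setU cK _ _); [|by move=> x []|by move=> x []].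
  apply: (le_volume cK) => [x [[]|[]]//|x Kx].
  by have [fx|/ltW fx] := leP (f x) (inf S - e); [left|right].
by lra.
Qed.

Lemma closed_sublevel K U f (l : R) : compact K -> open U -> K `<=` U ->
  (forall x, U x -> {for x, continuous f}) ->
  closed (K `&` [set x | f x <= l]).
Proof.
move=> cK oU KU fc; rewrite -openC openE => x xK.
have clK : closed K by apply: compact_closed => //; exact: norm_hausdorff.
have [Kx|nKx] := pselect (K x); last first.
  have : nbhs x (~` K) by apply: open_nbhs_nbhs; split=> //; rewrite openC.
  by apply: filterS => y nKy [].
have lfx : l < f x by rewrite ltNge; apply/negP => fxl; apply: xK.
have : \forall y \near x, l < f y by exact: cvgr_gt (fc x (KU _ Kx)) _ lfx.
by apply: filterS => y lfy [_ /=]; rewrite leNgt lfy.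
Qed.

Lemma powR2_gt1 (nu : R) : 0 < nu -> 1 < 2 `^ nu.
Proof.
move=> nu0; have := gt0_ltr_powR nu0 (x := 1) (y := 2).
by rewrite powR1; apply; rewrite ?nnegrE ?ltr1n.
Qed.

Lemma remez_factor_half (nu v w : R) : 0 < nu -> 0 < v -> w <= v ->
  v <= 2 * w ->
  0 <= v `^ nu / (v `^ nu - (v - w) `^ nu) <= 2 `^ nu / (2 `^ nu - 1).
Proof.
move=> nu0 v0 wv vw; have p1 := powR2_gt1 nu0.
set p := 2 `^ nu in p1 *; have vnu := powR_gt0 nu v0.
have vw_nu : p * (v - w) `^ nu <= v `^ nu.
  rewrite /p -powRM ?subr_ge0//; apply: ge0_ler_powR; first exact: ltW.
  - by rewrite nnegrE mulr_ge0 ?subr_ge0.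
  - by rewrite nnegrE ltW.
  - by lra.
have d_gt0 : 0 < v `^ nu - (v - w) `^ nu.
  rewrite subr_gt0; apply: (@le_lt_trans _ _ (v `^ nu / p)).
    by rewrite ler_pdivlMr ?(lt_trans ltr01)// mulrC.
  by rewrite ltr_pdivrMr ?(lt_trans ltr01)// ltr_pMr.
apply/andP; split; first by rewrite divr_ge0// ltW.
rewrite ler_pdivrMr// mulrAC ler_pdivlMr ?subr_gt0//.
by lra.
Qed.

End LevelSets.

Lemma sup_norm_const_mx (R : realType) (n : nat) (E : set 'rV[R]_n)
    (g : 'rV[R]_n -> R) :
  sup_norm E (fun x => const_mx (g x) : 'rV[R]_1) = sup [set `|g x| | x in E].
Proof.
by congr sup; apply: eq_imagel => x _; rewrite big_ord1 mxE.
Qed.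

Lemma smooth_le (R : realType) (n m : nat) (mu mu' : nat -> R) (N : nat)
    (M M' : R) (L : set 'rV[R]_n) (f : 'rV[R]_n -> 'rV[R]_m) :
  (forall j, weight_bound mu M j <= weight_bound mu' M' j) ->
  smooth mu N M L f -> smooth mu' N M' L f.
Proof.
move=> MM' [fC fM]; split=> // j x jN Lx.
exact: le_trans (fM j x jN Lx) (MM' j).
Qed.

Lemma CN_gt0 (R : realType) (h : R -> R) N : 0 < CN h N.
Proof. by rewrite exprn_gt0// mulr_gt0// expR_gt0. Qed.

Lemma remez_half_measure (R : realType) (n : nat) (K L E : set 'rV[R]_n.+1)
    (d : nat) (nu : R) (mu : nat -> R) (mut : R -> R) (M0 b0 l : R)
    (f : 'rV[R]_n.+1 -> R) :
  convex_body L -> K `<=` L -> compact K -> 0 < volume K -> 0 < nu ->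
  remez_inequality K d nu ->
  admissible_weight mu -> (forall j, (1 <= j)%N -> j%:R <= mu j) ->
  weight_extension mu mut -> 0 < b0 -> b0 < M0 ->
  admissible_tuple mu M0 (a_const K d) b0 ->
  let N := degree mu M0 (a_const K d) b0 in
  smooth mu N M0 L (fun x => const_mx (f x) : 'rV[R]_1) ->
  b0 <= sup [set `|f x| | x in K] ->
  closed E -> E `<=` K -> volume K <= 2 * volume E ->
  (forall x, E x -> `|f x| <= l) ->
  sup [set `|f x| | x in K] <=
    CN mut N * (2 `^ nu / (2 `^ nu - 1)) ^+ N * l.
Proof.
move=> L_body KL cK K0 nu0 remez mu_adm mu_ge mut_ext b0_gt0 b0M0 tuple N fN.
move=> b0_le clE EK KE fl.
have E0 : 0 < volume E by lra.
have E0' : (0 < lebesgue_rV E)%E.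
  by rewrite -(fineK (lebesgue_rV_fin_num cK EK)) lte_fin.
have := remez L mu mut M0 b0 1%N (fun x => const_mx (f x)) E L_body KL mu_adm
  mu_ge mut_ext b0_gt0 b0M0 isT.
rewrite mul1r !sup_norm_const_mx => /(_ tuple fN b0_le).
move=> /(_ (lebesgue_measurable_closed clE) EK E0') /le_trans; apply.
rewrite -/(volume K) -/(volume E) mul1r -/N -!mulrA ler_pM2l ?CN_gt0//.
have /andP[F0 FF] :=
  remez_factor_half nu0 K0 (le_volume cK (@subset_refl _ K) EK) KE.
have [x Ex] : E !=set0.
  apply/set0P; apply: contraTneq E0 => ->.
  by rewrite /volume lebesgue_rV_set0 ltxx.
apply: ler_pM.
- exact: exprn_ge0.
- apply: le_trans (normr_ge0 (f x)) _; apply: ub_le_sup; last by exists x.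
  by exists l => _ [y Ey <-]; exact: fl.
- by rewrite lerXn2r// nnegrE// (le_trans F0).
- apply: ge_sup; first by exists `|f x|; exists x.
  by move=> _ [y Ey <-]; exact: fl.
Qed.

Lemma smooth_norm_le (R : realType) (n : nat) (mu : nat -> R) (N : nat)
    (M : R) (L : set 'rV[R]_n) (f : 'rV[R]_n -> R) :
  smooth mu N M L (fun x => const_mx (f x) : 'rV[R]_1) ->
  forall x, L x -> `|f x| <= M.
Proof.
move=> [_ fM] x Lx; have := fM 0%N x (leq0n N) Lx.
rewrite (jet_norm_const_mx _ _ (leq0n N)) fact0 mul1r jet_sum0.
by rewrite /weight_bound big_geq// mulr1.
Qed.

Lemma smooth_continuous (R : realType) (n : nat) (mu : nat -> R) (N : nat)
    (M : R) (L : set 'rV[R]_n) (f : 'rV[R]_n -> R) :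
  smooth mu N M L (fun x => const_mx (f x) : 'rV[R]_1) ->
  exists U, [/\ open U, L `<=` U & forall x, U x -> {for x, continuous f}].
Proof.
move=> [[U [oU LU fC]] _]; exists U; split=> // x Ux.
have -> : f = component (fun x => const_mx (f x) : 'rV[R]_1) ord0.
  by apply/funext => y; rewrite /component mxE.
exact: class_C_continuous (fC ord0) Ux.
Qed.

Theorem theorem9p5 (R : realType) (n : nat) (n_gt0 : (0 < n)%N)
    (L K : set 'rV[R]_n) (d : nat) (nu : R)
    (L_body : convex_body L)
    (K_adm : fixed_degree K d)
    (nuK : remez_exponent K d nu)
    (KL : K `<=` L)
    (mu : nat -> R) (mut : R -> R)
    (mu_adm : admissible_weight mu)
    (mu_ge : forall j, (1 <= j)%N -> j%:R <= mu j)
    (mut_ext : weight_extension mu mut)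
    (H : R) (H_ge1 : 1 <= H)
    (mu_H : let a := fun j : nat =>
              ((\prod_(1 <= i < j.+1) mu i) / (j`!)%:R) `^ (j%:R^-1) in
            forall j k, (1 <= j)%N -> (j <= k)%N -> a j <= H * a k)
    (M0 m0 : R) (m0_gt0 : 0 < m0) (M0_ge : m0 <= M0) :
  let beta0 := n%:R * H * (1 + 2 * M0 / m0) in
  admissible_tuple mu (2 * M0) (a_const K d * beta0) m0 ->
  let N := degree mu (2 * M0) (a_const K d * beta0) m0 in
  forall f : 'rV[R]_n -> R,
    smooth mu N M0 L (fun x => const_mx (f x) : 'rV[R]_1) ->
    m0 <= inf [set `|f x| | x in L] ->
    sup [set `|f x| | x in K] <=
      CN mut N ^+ 2 * (2 `^ nu / (2 `^ nu - 1)) ^+ (2 * N) *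
      inf [set `|f x| | x in K].
Proof.
case: n n_gt0 L K L_body K_adm nuK KL => // n _ L K L_body K_adm nuK KL.
move=> beta0 tuple N f fN m0_inf.
have f_ge x : L x -> m0 <= `|f x|.
  move=> Lx; apply: le_trans m0_inf _; apply: ge_inf; last by exists x.
  by exists 0 => _ [y _ <-].
have f_le := smooth_norm_le fN.
have [[K_set cK _] _] := K_adm; have [x0 Kx0] := K_set.
have [/andP[nu0 _] _ remez] := nuK.
have K0 : 0 < volume K.
  rewrite -lte_fin /volume fineK ?(lebesgue_rV_fin_num cK)//.
  exact: admissible_set_measure_gt0 K_adm.1.
have M0_gt0 : 0 < M0 := lt_le_trans m0_gt0 M0_ge.
have r0 : 0 < M0 / m0 by rewrite divr_gt0.
have beta_ge : (1 + M0 / m0) * H <= beta0.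
  have n1 : 1 <= n.+1%:R :> R by rewrite ler1n.
  have Hr : 0 <= H * (1 + 2 * M0 / m0).
    by rewrite mulr_ge0 ?(le_trans ler01)//; lra.
  rewrite /beta0 -mulrA; apply: le_trans (ler_peMl Hr n1).
  by rewrite mulrC ler_wpM2l ?(le_trans ler01)//; lra.
have beta_ge1 : 1 <= beta0.
  apply: le_trans beta_ge; rewrite -[leLHS]mulr1 ler_pM// lerDl ltW//.
have beta_gt0 : 0 < beta0 := lt_le_trans ltr01 beta_ge1.
pose mu' j := beta0 * mu j.
have mu_gt0 j : (0 < j)%N -> 0 < mu j.
  by move=> j0; rewrite (lt_le_trans _ (mu_ge j j0))// ltr0n.
have bound_le j : weight_bound mu M0 j <= weight_bound mu' (2 * M0) j.
  have P0 := weight_prod_gt0 j mu_adm.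
  rewrite /weight_bound big_split/= prodr_const_nat subn1/=.
  rewrite ler_pM ?(ltW M0_gt0) ?(ltW P0)//; first by lra.
  by rewrite ler_peMl ?(ltW P0)// exprn_ege1.
have bound_le' j : weight_bound mu' M0 j <= weight_bound mu' (2 * M0) j.
  have P0 := weight_prod_gt0 j (admissible_weightZ beta_gt0 mu_adm).
  by rewrite ler_wpM2r ?(ltW P0)//; lra.
pose g x := M0 * m0 / f x.
have gN0 : smooth mu' N M0 L (fun x => const_mx (g x) : 'rV[R]_1).
  exact: smooth_reciprocal mu_adm H_ge1 mu_H m0_gt0 M0_ge beta_ge fN f_ge.
have gE x : L x -> `|g x| = M0 * m0 / `|f x|.
  by move=> Lx; rewrite normrM normfV ger0_norm// ltW// mulr_gt0.
have [U [oU LU fc]] := smooth_continuous fN.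
have [V [oV LV gc]] := smooth_continuous gN0.
have [l ml lP] : exists2 l : R, m0 <= l & forall e : R, 0 < e ->
    volume K <= 2 * volume (K `&` [set x | `|f x| <= l + e]) /\
    volume K <= 2 * volume (K `&` [set x | l - e <= `|f x|]).
  apply: (approximate_median (M := M0) cK K0) => x /KL Lx.
  by rewrite f_ge// f_le.
have NE : N = degree mu' (2 * M0) (a_const K d) m0 by rewrite degreeZ.
pose C := CN mut N * (2 `^ nu / (2 `^ nu - 1)) ^+ N.
have C_gt0 : 0 < C.
  have p1 := powR2_gt1 nu0.
  by rewrite mulr_gt0 ?CN_gt0// exprn_gt0// divr_gt0 ?subr_gt0.
have Remez (h : 'rV[R]_n.+1 -> R) E (k : R) :
    smooth mu' N (2 * M0) L (fun x => const_mx (h x) : 'rV[R]_1) ->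
    (forall x, L x -> m0 <= `|h x|) -> closed E -> E `<=` K ->
    volume K <= 2 * volume E -> (forall x, E x -> `|h x| <= k) ->
    forall x, K x -> `|h x| <= C * k.
  move=> hN h_ge clE EK KE hk x Kx.
  have hK y : K y -> `|h y| <= sup [set `|h x| | x in K].
    move=> Ky; apply: ub_le_sup; last by exists y.
    by exists (2 * M0) => _ [z /KL Lz <-]; exact: smooth_norm_le hN _ Lz.
  apply: le_trans (hK _ Kx) _; rewrite /C -(CNZ beta_gt0) NE.
  apply: (remez_half_measure L_body KL cK K0 nu0 remez
    (admissible_weightZ beta_gt0 mu_adm) _ (weight_extensionZ beta_gt0 mut_ext)
    m0_gt0 _ _ _ _ clE EK KE hk).
  - by move=> j j0; rewrite (le_trans (mu_ge j j0))// ler_peMl// ltW// mu_gt0.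
  - by lra.
  - exact: admissible_tupleZ.
  - by rewrite -/mu' -NE.
  - exact: le_trans (h_ge _ (KL _ Kx0)) (hK _ Kx0).
have f_le_l x : K x -> `|f x| <= C * l.
  move=> Kx; apply/ler_addgt0Pr => e e0.
  have eC : 0 < e / C by rewrite divr_gt0.
  have -> : C * l + e = C * (l + e / C).
    by rewrite mulrDr (mulrCA C e) divff ?mulr1// lt0r_neq0.
  apply: (@Remez f (K `&` [set x | `|f x| <= l + e / C])) Kx => //.
  - exact: smooth_le fN.
  - apply: (closed_sublevel (f := fun x => `|f x|) cK oU) => [y /KL/LU//|y Uy].
    exact: cvg_norm (fc y Uy).
  - by have [] := lP _ eC.
  - by move=> y [].
have l_le_f x : K x -> l <= C * `|f x|.
  move=> Kx; apply/ler_addgt0Pr => e e0; rewrite -lerBlDr.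
  have [le|el] := leP l e.
    by rewrite (le_trans (y := 0)) ?subr_le0// mulr_ge0// ltW.
  have le0 : 0 < l - e by rewrite subr_gt0.
  have fx0 := lt_le_trans m0_gt0 (f_ge _ (KL _ Kx)).
  have : `|g x| <= C * (M0 * m0 / (l - e)).
    apply: (@Remez g (K `&` [set x | `|g x| <= M0 * m0 / (l - e)])) Kx => //.
    - exact: smooth_le gN0.
    - move=> y Ly; rewrite gE// ler_pdivlMr ?(lt_le_trans m0_gt0 (f_ge _ Ly))//.
      by rewrite mulrC ler_pM2r// f_le.
    - apply: (closed_sublevel (f := fun x => `|g x|) cK oV) => [y /KL/LV//|y Vy].
      exact: cvg_norm (gc y Vy).
    - have [_ KE] := lP _ e0; apply: (le_trans KE).
      rewrite ler_pM2l//; apply: (le_volume cK) => [y []//|y [Ky /= fy]].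
      split=> //=; rewrite gE; last exact: KL.
      by rewrite ler_pM2l ?mulr_gt0// lef_pV2// posrE (lt_le_trans le0).
    - by move=> y [].
  rewrite gE; last exact: KL.
  rewrite [X in _ <= X -> _]mulrCA ler_pM2l ?mulr_gt0// ler_pdivlMr//.
  by rewrite ler_pdivrMl// (mulrC C).
have C2 : CN mut N ^+ 2 * (2 `^ nu / (2 `^ nu - 1)) ^+ (2 * N) = C * C.
  by rewrite /C mulrACA -!expr2 mulnC exprM.
rewrite C2; have CC0 : 0 < C * C by exact: mulr_gt0.
apply: ge_sup; first by exists `|f x0|; exists x0.
move=> _ [x Kx <-]; rewrite -ler_pdivrMl//.
apply: lb_le_inf; first by exists `|f x0|; exists x0.
move=> _ [y Ky <-]; rewrite ler_pdivrMl// -mulrA.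
by apply: le_trans (f_le_l _ Kx) _; rewrite ler_pM2l// l_le_f.
Qed.
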